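(* Let $n,T\ge1$, $M>0$, $\epsilon>0$. Run $\textsc{SubmodPFTAL}(\{f_t\}_{t=1}^T,M,H,L,[n],\epsilon)$ with $H$ of order $M\sqrt{T}/\sqrt n$ (i.e. $H=O(M\sqrt T/\sqrt n)$) and $L=4M+H\sqrt n$. Then for every sequence of submodular functions $f_1,\dots,f_T:2^{[n]}\to[-M,M]$, $$\mathbb{E}\Big[\sum_{t=1}^Tf_t(S_t)-\min_{S\subseteq[n]}\sum_{t=1}^Tf_t(S)\Big]\le\tilde O\!\Big(\frac{n^{3/2}M\sqrt T}{\epsilon}\Big),$$ where the expectation is over the randomness of $\textsc{TBAP}$ and of the sampling used to choose the sets $S_t$, and $\tilde O$ hides polylogarithmic factors in $T$.
   Context: A function $f:2^{[n]}\to\mathbb{R}$ is submodular if $f(S'\cup\{i\})-f(S')\ge f(S\cup\{i\})-f(S)$ for all $S'\subseteq S\subseteq[n]$ and $i\in[n]\setminus S$. Let $\mathcal{K}=[0,1]^n$ and for $S\subseteq[n]$ let $\mathcal{X}_S\in\{0,1\}^n$ be its characteristic vector. Every $x\in\mathcal{K}$ can be written as $x=\sum_{i=0}^n\mu_i\mathcal{X}_{B_i}$ with $\mu_i\ge 0$, $\sum_i\mu_i=1$, for a maximal chain $\emptyset=B_0\subset\cdots\subset B_n=[n]$; let $\pi$ be the permutation with $B_{\pi(i)}=B_{\pi(i)-1}\cup\{i\}$. The Lovasz extension is $\hat f(x)=\sum_i\mu_if(B_i)=\mathbb{E}_{\tau\sim U[0,1]}[f(\{i:x(i)\ge\tau\})]$,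 and $\nabla\hat f(x)(i)=f(B_{\pi(i)})-f(B_{\pi(i)-1})$ is a subgradient of $\hat f$ at $x$. $\textsc{TBAP}(\{z_t\},\mu,\epsilon)$: receives online vectors $z_1,\dots,z_T\in\mathbb{R}^d$, maintains a complete binary tree with leaves $z_t$, each internal node storing the sum of leaves in its subtree plus independent noise $\gamma$ with density $\propto\exp(-\|\gamma\|_2\epsilon/(\mu(\lceil\log_2T\rceil+1)))$; at time $t$ outputs $v_t$, the sum of the noisy values of at most $\lceil\log_2T\rceil+1$ nodes whose subtrees partition $\{1,\dots,t\}$. $\textsc{SubmodPFTAL}(\{f_t\},M,H,L,[n],\epsilon)$: choose any $S_1\subseteq[n]$, $x_1=\mathcal{X}_{S_1}$, output $S_1$. For each $t$: after observing $f_t$, pass $\nabla\hat f_t(x_t)+Hx_t$ to $\textsc{TBAP}$ (norm bound $L$, privacy $\epsilon$), receive $v_t$; set $x_{t+1}=\arg\min_{x\in\mathcal{K}}v_t^\top x+\frac H2\sum_{j=1}^t\|x-x_j\|_2^2$, sample $\tau_{t+1}\sim U[0,1]$ and output $S_{t+1}=\{i:x_{t+1}(i)>\tau_{t+1}\}$.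
   Formalization: The bound is proved for some choice of H with 0 < H ≤ c·M√T/√n (it fails when H is truly of that order), and the constant hidden in Õ may depend on an upper bound for ε (a constant uniform over all ε > 0 is impossible). *)

(* Defs.v *)
From HB Require Import structures.
From mathcomp Require Import all_boot all_order all_algebra all_fingroup.
From mathcomp Require Import all_classical all_reals all_analysis.

Set Implicit Arguments.
Unset Strict Implicit.
Unset Printing Implicit Defensive.

Import Order.TTheory GRing.Theory Num.Theory.
Import numFieldNormedType.Exports.

Local Open Scope classical_set_scope.
Local Open Scope ring_scope.

(* MathComp with MathComp-Analysis.  The ground set [n] is 'I_n, so the ranks
   pi(i) run over 0..n-1 instead of 1..n; rounds are natural numbers 1..T. *)

Definition submodular (R : realType) n (f : {set 'I_n} -> R) : Prop :=
  forall (S' S : {set 'I_n}) (i : 'I_n), S' \subset S -> i \notin S ->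
    f (i |: S') - f S' >= f (i |: S) - f S.

Definition charvec (R : realType) n (S : {set 'I_n}) : 'rV[R]_n :=
  \row_i (i \in S)%:R.

Definition cube (R : realType) n : set 'rV[R]_n :=
  [set x | forall i, 0 <= x ord0 i <= 1].

Definition dotv (R : realType) n (x y : 'rV[R]_n) : R :=
  \sum_i x ord0 i * y ord0 i.

Definition norm2 (R : realType) n (x : 'rV[R]_n) : R :=
  Num.sqrt (\sum_i x ord0 i ^+ 2).

(* A permutation pi encodes the maximal chain B_0 < ... < B_n in which the
   element i enters at step pi(i) + 1. *)
Definition chain n (pi : {perm 'I_n}) (k : nat) : {set 'I_n} :=
  [set i | (pi i < k)%N]%SET.

Definition chain_decomposes (R : realType) n (x : 'rV[R]_n)
    (pi : {perm 'I_n}) : Prop :=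
  exists mu : 'I_n.+1 -> R,
    [/\ forall k, 0 <= mu k, \sum_k mu k = 1 &
        x = \sum_k mu k *: charvec R (chain pi k)].

Definition lovasz_grad (R : realType) n (f : {set 'I_n} -> R)
    (pi : {perm 'I_n}) : 'rV[R]_n :=
  \row_i (f (chain pi (pi i).+1) - f (chain pi (pi i))).

Definition row_of (R : realType) n (s : n.-tuple R) : 'rV[R]_n :=
  \row_i tnth s i.

(* The chain of a point x is not unique when x has ties, so the algorithm comes
   with a rule that selects one.  Measurability of the rule ensures that the
   iterates are random variables. *)
Definition chain_rule (R : realType) n (r : 'rV[R]_n -> {perm 'I_n}) : Prop :=
  (forall x, cube x -> chain_decomposes x (r x)) /\
  (forall pi, measurable [set s : n.-tuple R | r (row_of s) = pi]).

(* Integral of a nonnegative function against Lebesgue measure on R^n, as an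
   iterated integral (Tonelli). *)
Fixpoint lebesgue_int (R : realType) n : (n.-tuple R -> \bar R) -> \bar R :=
  match n with
  | 0 => fun F => F [tuple]
  | n'.+1 => fun F =>
      (\int[@lebesgue_measure R]_y lebesgue_int (fun s => F (cons_tuple y s)))%E
  end.

(* The number of levels of the tree, leaves included, is (up_log 2 T).+1, where
   up_log 2 T is the rounded up binary logarithm of T. *)
Definition noise_kernel (R : realType) n (T : nat) (mu eps : R)
    (s : n.-tuple R) : R :=
  expR (- (norm2 (row_of s) * eps / (mu * (up_log 2 T).+1%:R))).

Definition has_density_prop_to (R : realType) d (Omega : measurableType d)
    (P : probability Omega R) n (X : Omega -> n.-tuple R)
    (g : n.-tuple R -> R) : Prop :=
  exists c : R, forall A : set (n.-tuple R), measurable A ->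
    P (X @^-1` A) = (c%:E * lebesgue_int (fun s => (g s * \1_A s)%:E))%E.

(* Complete binary tree with 2 ^ up_log 2 T leaves, those after the T-th being
   empty.  A node is a level k (leaves have level 0) and a position j in that
   level; the leaf of round s is at position s - 1. *)
Definition node (T : nat) :=
  {k : 'I_(up_log 2 T).+1 & 'I_(2 ^ (up_log 2 T - k))}.

Definition in_subtree T (v : node T) (s : nat) : bool :=
  (s.-1 %/ 2 ^ tag v == tagged v)%N.

Definition tbap_cover T (t : nat) (N : {set node T}) : Prop :=
  (#|N| <= (up_log 2 T).+1)%N /\
  (forall s, (1 <= s <= 2 ^ up_log 2 T)%N ->
     #|[set v in N | in_subtree v s]%SET| = (s <= t)%N).

(* leaf_noise tells whether the leaves are perturbed as the internal nodes. *)
Definition noisy_value (R : realType) n T (leaf_noise : bool)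
    (noise : node T -> 'rV[R]_n) (z : nat -> 'rV[R]_n) (v : node T) : 'rV[R]_n :=
  \sum_(1 <= s < T.+1 | in_subtree v s) z s +
  (if leaf_noise || (0 < tag v)%N then noise v else 0).

Definition tbap_output (R : realType) n T (leaf_noise : bool)
    (noise : node T -> 'rV[R]_n) (N : {set node T}) (z : nat -> 'rV[R]_n)
  : 'rV[R]_n := \sum_(v in N) noisy_value leaf_noise noise z v.

Definition is_argmin (R : realType) (X : Type) (K : set X) (F : X -> R)
    (x : X) : Prop := K x /\ forall y, K y -> F x <= F y.

(* tau (t + 1) is the threshold that produces S_(t+1), so indices 2..T+1 are
   used.  Independence of all the node noises and all the thresholds together
   (the sets A v and B t may be full). *)
Definition mutually_independent (R : realType) d (Omega : measurableType d)
    (P : probability Omega R) n T (gam : node T -> {RV P >-> n.-tuple R})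
    (tau : nat -> {RV P >-> R}) : Prop :=
  forall (A : node T -> set (n.-tuple R)) (B : nat -> set R),
    (forall v, measurable (A v)) -> (forall t, measurable (B t)) ->
    P ((\bigcap_v (gam v @^-1` A v)) `&`
       (\bigcap_(t in [set t | (2 <= t <= T.+1)%N]) (tau t @^-1` B t))) =
    ((\prod_v P (gam v @^-1` A v)) *
     (\prod_(2 <= t < T.+2) P (tau t @^-1` B t)))%E.

(* A run of SubmodPFTAL on the losses f_1, ..., f_T: gam is the noise of the
   tree, cover t the set of nodes used at round t, rule t the choice of chains
   defining the subgradient of the Lovasz extension of f_t. *)
Record submod_pftal (R : realType) d (Omega : measurableType d)
    (P : probability Omega R) n (T : nat) (f : nat -> {set 'I_n} -> R)
    (H L eps : R) (leaf_noise : bool) (cover : nat -> {set node T})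
    (rule : nat -> 'rV[R]_n -> {perm 'I_n}) (S1 : {set 'I_n})
    (gam : node T -> {RV P >-> n.-tuple R}) (tau : nat -> {RV P >-> R})
    (x : nat -> Omega -> 'rV[R]_n) (S : nat -> Omega -> {set 'I_n}) : Prop := {
  pftal_cover : forall t, (1 <= t <= T)%N -> tbap_cover t (cover t);
  pftal_rule : forall t, (1 <= t <= T)%N -> chain_rule (rule t);
  pftal_noise : forall v, has_density_prop_to P (gam v) (noise_kernel T L eps);
  pftal_tau : forall t, (2 <= t <= T.+1)%N -> forall A : set R, measurable A ->
    P (tau t @^-1` A) = uniform_prob (@ltr01 R) A;
  pftal_indep : mutually_independent gam tau;
  pftal_S1 : forall w, S 1 w = S1;
  pftal_x1 : forall w, x 1 w = charvec R S1;
  pftal_x : forall w t, (1 <= t <= T)%N ->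
    let z s := lovasz_grad (f s) (rule s (x s w)) + H *: x s w in
    let v := tbap_output leaf_noise (fun u => row_of (gam u w)) (cover t) z in
    is_argmin (@cube R n)
      (fun y => dotv v y + H / 2 * \sum_(1 <= j < t.+1) norm2 (y - x j w) ^+ 2)
      (x t.+1 w);
  pftal_S : forall w t, (1 <= t <= T)%N ->
    S t.+1 w = [set i | x t.+1 w ord0 i > tau t.+1 w]%SET }.

Definition total_loss (R : realType) n (T : nat) (f : nat -> {set 'I_n} -> R)
    (S : {set 'I_n}) : R := \sum_(1 <= t < T.+1) f t S.

Definition regret (R : realType) n (T : nat) (f : nat -> {set 'I_n} -> R)
    (S : nat -> {set 'I_n}) : R :=
  \sum_(1 <= t < T.+1) f t (S t) -
  \big[Num.min/total_loss T f finset.set0]_(A : {set 'I_n}) total_loss T f A.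

(* Main.v *)
(** Since z_t = grad f_t(x_t) + H x_t, completing the square turns the update
into x_(t+1) = clamp (- (sum of the gradients + noise) / (H t)), coordinatewise.
Comparing it with the noiseless leader and applying "be the leader" to the
losses g_t . y + H |y|^2 / 2 bounds the linear regret by H T n / 2 plus
(4 M / H) sum_t (|noise_t| / t + 8 M / (t + 1)), because the l1 norm of a
subgradient is at most 4 M.  The dilation s |-> s / 2 gives the noise of a node
the tail 2^n exp (- b r / 2), hence mean norm O (n / b), without polar
coordinates.  The iterates are functions of the noises only, and the thresholds
are uniform and independent of them, so f_t(S_t) has the same mean as the
Lovasz extension f_t(0) + g_t . x_t.  The choice H = M / sqrt (n T) balances the
terms. *)

Require Import Defs.
From HB Require Import structures.
From mathcomp Require Import all_boot all_order all_algebra all_fingroup.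
From mathcomp Require Import all_classical all_reals all_analysis.
From mathcomp Require Import measurable_realfun.
From mathcomp Require Import ring lra zify.

Set Implicit Arguments.
Unset Strict Implicit.
Unset Printing Implicit Defensive.

Import Order.TTheory GRing.Theory Num.Theory.
Import numFieldNormedType.Exports.

Local Open Scope classical_set_scope.
Local Open Scope ring_scope.

(** * Subgradients of the Lovasz extension *)

Section greedy_gradient.
Context {R : realType} {n : nat}.
Implicit Types (f : {set 'I_n} -> R) (pi : {perm 'I_n}) (A : {set 'I_n}).

(** A set closed under smaller ranks contains everything up to its largest rank. This serves for the
    superlevel sets of a point. *)
Lemma initial_segment_chain pi A : (forall i j, j \in A -> (pi i <= pi j)%N -> i \in A) ->
  exists2 k, (k <= n)%N & A = chain pi k.
Proof.
(* One more than the largest rank in [A]; the empty maximum is 0, as it should be for empty [A]. *)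
move=> dA; exists (\max_(j in A) (pi j).+1)%N.
  by apply/bigmax_leqP => i _; exact: ltn_ord.
apply/setP => i; rewrite inE; apply/idP/idP => [iA|].
  by apply: (leq_trans _ (leq_bigmax_cond _ iA)).
have [A0|] := eqVneq #|A| 0%N.
  by rewrite big1 // => j jA; move: A0; rewrite (cardsD1 j) jA.
rewrite -lt0n => A0; have [j jA ->] := eq_bigmax_cond (fun j => (pi j).+1) A0.
exact: dA.
Qed.

Lemma chain0 pi : chain pi 0 = finset.set0.
Proof. by apply/setP => i; rewrite !inE. Qed.

Lemma chainT pi : chain pi n = [set: 'I_n]%SET.
Proof. by apply/setP => i; rewrite !inE ltn_ord. Qed.

Lemma chainS pi (k : 'I_n) : chain pi k.+1 = ((pi^-1)%g k) |: chain pi k.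
Proof.
apply/setP => i; rewrite !inE ltnS leq_eqVlt; congr orb.
by rewrite -(inj_eq (@perm_inj _ pi)) permKV.
Qed.

Lemma chain_notin pi (k : 'I_n) : (pi^-1)%g k \notin chain pi k.
Proof. by rewrite inE permKV ltnn. Qed.

Lemma sum_chainS pi (k : 'I_n) A (F : 'I_n -> R) :
  \sum_(i in A :&: chain pi k.+1) F i =
  (if (pi^-1)%g k \in A then F ((pi^-1)%g k) else 0) +
  \sum_(i in A :&: chain pi k) F i.
Proof.
rewrite chainS finset.setIUr; case: ifPn => kA.
  rewrite (finset.setIidPr _) ?finset.sub1set // big_setU1 //.
  by rewrite inE negb_and chain_notin orbT.
rewrite add0r; apply: eq_bigl => i; rewrite !inE.
by case: eqP => [->|_]; rewrite ?(negbTE kA) ?andbF.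
Qed.

(** The marginals telescope, so the affine function given by the subgradient agrees with [f] on the
    whole chain. *)
Lemma lovasz_grad_chain f pi k : (k <= n)%N ->
  f (chain pi k) = f finset.set0 + \sum_(i in chain pi k) lovasz_grad f pi ord0 i.
Proof.
elim: k => [|k IH] kn; first by rewrite chain0 big_set0 addr0.
have -> : chain pi k.+1 = ([set: 'I_n] :&: chain pi (Ordinal kn).+1)%SET.
  by rewrite finset.setTI.
rewrite sum_chainS inE finset.setTI /= mxE permKV addrCA !finset.setTI -IH ?(ltnW kn) //.
by rewrite subrK.
Qed.

(* Membership of the subgradient in the base polytope; it replaces the
   convexity of the Lovasz extension. *)
Lemma lovasz_grad_le f pi A : submodular f ->
  f finset.set0 + \sum_(i in A) lovasz_grad f pi ord0 i <= f A.
Proof.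
move=> sf; rewrite -(finset.setIT A) -(chainT pi).
(* Intersecting [A] with the growing chain allows an induction on [k]; [k = n] gives back [A]. *)
suff H k : (k <= n)%N -> f finset.set0 +
    \sum_(i in A :&: chain pi k) lovasz_grad f pi ord0 i <= f (A :&: chain pi k)%SET.
  exact: H.
elim: k => [|k IH] kn.
  by rewrite chain0 finset.setI0 big_set0 addr0.
rewrite (sum_chainS pi (Ordinal kn)) (chainS pi (Ordinal kn)) /=.
set i := ((pi^-1)%g _).
(* Diminishing returns: adding [i] to the smaller set [A :&: chain pi k] gains at least its marginal
   along the chain, which is the entry of the subgradient at [i]. *)
have := IH (ltnW kn); have := @sf (A :&: chain pi k)%SET (chain pi k) i.
rewrite finset.subsetIr (chain_notin pi (Ordinal kn)) => /(_ isT isT) {}sf IHk.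
case: ifPn => iA.
  rewrite mxE permKV (chainS pi (Ordinal kn)) /= -/i.
  rewrite finset.setIUr (_ : (A :&: [set i])%SET = [set i]%SET).
    by move: sf IHk; lra.
  by apply/finset.setIidPr; rewrite finset.sub1set.
rewrite add0r finset.setIUr; suff -> : (A :&: [set i] = finset.set0)%SET.
  by rewrite finset.set0U.
by apply/setP => j; rewrite !inE; case: eqP => [->|]; rewrite ?(negbTE iA) ?andbF.
Qed.

(** The sum of absolute values is twice the sum over the nonnegative entries [Q], minus the full
    sum. Bounding the former by [lovasz_grad_le] and telescoping the latter leaves [2 f(Q) -
    f(empty) - f([n])], hence a bound free of [n]. *)
Lemma lovasz_grad_l1 f pi (M : R) : submodular f ->
  (forall A, - M <= f A <= M) ->
  \sum_i `|lovasz_grad f pi ord0 i| <= 4 * M.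
Proof.
move=> sf fM; set g := lovasz_grad f pi ord0.
pose Q := [set i | 0 <= g i]%SET.
have gT := lovasz_grad_chain f pi (leqnn n); rewrite chainT -/g in gT.
have gQ := lovasz_grad_le pi Q sf; rewrite -/g in gQ.
have -> : \sum_i `|g i| = \sum_(i in Q) g i *+ 2 - \sum_(i in [set: 'I_n]%SET) g i.
  rewrite [X in _ = X - _]big_mkcond [X in _ = _ - X]big_mkcond -sumrB.
  apply: eq_bigr => i _; rewrite !inE; case: ifPn => [gi|].
    by rewrite ger0_norm // mulr2n; lra.
  by rewrite -ltNge => gi; rewrite ltr0_norm // sub0r.
rewrite sumrMnl mulr2n.
by have := fM Q; have := fM finset.set0; have := fM [set: 'I_n]%SET; lra.
Qed.

(** Each characteristic vector of the decomposition is nonincreasing in the rank, and the weights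
    are nonnegative. *)
Lemma chain_decomposes_ge (x : 'rV[R]_n) pi i j : chain_decomposes x pi ->
  (pi i <= pi j)%N -> x ord0 j <= x ord0 i.
Proof.
move=> [mu [mu0 _ ->]] ij; rewrite !summxE; apply: ler_sum => k _.
rewrite !mxE ler_wpM2l // ler_nat !inE; case: ltnP => // /(leq_ltn_trans ij) ->.
by [].
Qed.

(** A superlevel set of [x] belongs to its chain, where [f] is affine with the same subgradient for
    every [r]. Averaging over a uniform [r] will turn the indicators into the entries of [x]. *)
Lemma lovasz_grad_threshold f pi (x : 'rV[R]_n) (r : R) : chain_decomposes x pi ->
  f [set i | r < x ord0 i]%SET =
  f finset.set0 + \sum_i lovasz_grad f pi ord0 i * (r < x ord0 i)%R%:R.
Proof.
move=> xpi.
have [i j /[!inE] jA ij|k kn Ak] := @initial_segment_chain pi [set i | r < x ord0 i]%SET.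
  by apply: lt_le_trans jA (chain_decomposes_ge xpi ij).
rewrite {1}Ak lovasz_grad_chain // -Ak; congr +%R.
rewrite big_mkcond; apply: eq_bigr => i _; rewrite inE.
by case: ifP; rewrite ?mulr1 ?mulr0.
Qed.

End greedy_gradient.

(** * Follow the leader *)

Section follow_the_leader.
Context {R : realType}.
Implicit Types (g N : nat -> R) (a b c p q u H : R).

(** Projection of a real onto the unit interval. *)
Definition clamp p : R := Num.max 0 (Num.min p 1).

Lemma clamp_itv p : 0 <= clamp p <= 1.
Proof.
rewrite /clamp; case: (leP p 1) => p1; last by rewrite max_r ?ler01 ?lexx.
by case: (leP 0 p) => p0; rewrite ?lexx ?ler01 ?p0 ?p1.
Qed.

Lemma clamp_lipschitz p q : `|clamp p - clamp q| <= `|p - q|.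
Proof.
wlog pq : p q / p <= q.
  by move=> W; case: (leP p q) => [/W//|/ltW/W]; rewrite distrC [X in _ <= X -> _]distrC.
rewrite distrC [leRHS]distrC (ger0_norm (_ : 0 <= q - p)) ?subr_ge0 // ler_norml /clamp.
by case: (leP p 1) => ?; case: (leP q 1) => ?; case: (leP 0 p) => ?;
  case: (leP 0 q) => ?; case: (leP (0 : R) 1) => ?; lra.
Qed.

(** Minimality of the projected vertex of a parabola, with the strong convexity gap that later gives
    uniqueness of the minimiser. *)
Lemma clamp_argmin a b u : 0 < b -> 0 <= u <= 1 ->
  a * clamp (- a / b) + b / 2 * clamp (- a / b) ^+ 2 +
    b / 2 * (u - clamp (- a / b)) ^+ 2 <= a * u + b / 2 * u ^+ 2.
Proof.
move=> b0 u01; set p := - a / b; set c := clamp p.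
have -> : a = - (p * b) by rewrite /p mulfVK ?opprK ?gt_eqF.
(* After expansion, what remains is the variational inequality of the projection [c] of [p]. *)
suff : 0 <= b * ((c - p) * (u - c)) by lra.
rewrite pmulr_rge0 // /c /clamp.
case: (leP p 1) => ?; case: (leP 0 p) => ?; case: (leP (0 : R) 1) => ?; try lra.
all: first [by rewrite subrr mul0r | by apply: mulr_ge0; lra | by rewrite -mulrNN mulr_ge0; lra].
Qed.

(** [y t] minimises the sum of the first [t] regularised losses, the loss of round [t] included. *)
Lemma be_the_leader H g (y : nat -> R) (T : nat) u : 0 < H -> 0 <= u <= 1 ->
  (forall t, y t = clamp (- (\sum_(1 <= j < t.+1) g j) / (H * t%:R))) ->
  \sum_(1 <= t < T.+1) (g t * y t + H / 2 * y t ^+ 2) <=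
  \sum_(1 <= t < T.+1) (g t * u + H / 2 * u ^+ 2).
Proof.
move=> H0 u01 yE; elim: T u u01 => [|T IH] u u01; first by rewrite !big_geq.
rewrite big_nat_recr //=.
(* The first [T] rounds are compared with the next leader [y T.+1], which in turn beats [u] on all
   [T.+1] rounds. *)
apply: (@le_trans _ _ _ _ _ (lerD (IH (y T.+1) _) (lexx _))); first by rewrite yE clamp_itv.
rewrite -(big_nat_recr T.+1 1 (fun t => g t * y T.+1 + H / 2 * y T.+1 ^+ 2)) //=.
rewrite !big_split /= -!mulr_suml !sumr_const_nat subn1 /=.
have HT : 0 < H * T.+1%:R by rewrite mulr_gt0 // ltr0n.
have := clamp_argmin (\sum_(1 <= j < T.+2) g j) HT u01; rewrite -yE.
have : 0 <= H * T.+1%:R / 2 * (u - y T.+1) ^+ 2.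
  by rewrite mulr_ge0 ?sqr_ge0 // divr_ge0 // ltW.
rewrite -(mulr_natr H); set A := \sum_(_ <= _ < _) _; set m := T.+1%:R; set z := y _.
by lra.
Qed.

(** Before projection the two points differ by the scaled noise and by the change of a running
    average of gradients when one more is added, which is at most [2 * B / t.+1%:R]. *)
Lemma leader_drift H g N B (t : nat) : 0 < H -> (0 < t)%N ->
  (forall j, (1 <= j <= t.+1)%N -> `|g j| <= B) ->
  `|clamp (- (\sum_(1 <= j < t.+1) g j + N t) / (H * t%:R)) -
    clamp (- (\sum_(1 <= j < t.+2) g j) / (H * t.+1%:R))| <=
  (`|N t| / t%:R + 2 * B / t.+1%:R) / H.
Proof.
move=> H0 t0 gB; apply: (le_trans (clamp_lipschitz _ _)).
rewrite (big_nat_recr t.+1) //=; set G := \sum_(_ <= _ < _) _.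
have tp : 0 < t%:R :> R by rewrite ltr0n.
have tp1 : 0 < t.+1%:R :> R by rewrite ltr0n.
have -> : - (G + N t) / (H * t%:R) - - (G + g t.+1) / (H * t.+1%:R) =
    (- (N t / t%:R) + (g t.+1 * t%:R - G) / t%:R / t.+1%:R) / H.
  have -> : t.+1%:R = t%:R + 1 :> R by rewrite -natr1.
  by field; rewrite !gt_eqF // addr_gt0.
rewrite normrM (ger0_norm (_ : 0 <= H^-1)) ?invr_ge0 ?(ltW H0) // ler_wpM2r ?invr_ge0 ?(ltW H0) //.
apply: le_trans (ler_normD _ _) _; rewrite normrN normrM.
rewrite (ger0_norm (_ : 0 <= t%:R^-1)) ?invr_ge0 ?ler0n //.
rewrite lerD2l normrM (ger0_norm (_ : 0 <= t.+1%:R^-1)) ?invr_ge0 ?ler0n //.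
rewrite ler_wpM2r ?invr_ge0 ?ler0n // normrM (ger0_norm (_ : 0 <= t%:R^-1)) ?invr_ge0 ?ler0n //.
rewrite ler_pdivrMr //; apply: le_trans (ler_normB _ _) _.
have GB : `|G| <= B * t%:R.
  apply: le_trans (ler_norm_sum _ _ _) _.
  rewrite -[t in t%:R]/(t.+1.-1) -subn1 mulr_natr -sumr_const_nat.
  by rewrite !big_nat; apply: ler_sum => j /andP[j1 jt]; apply: gB; rewrite j1 ltnW.
have gt : `|g t.+1| <= B by apply: gB; rewrite ltnSn.
by rewrite normrM normr_nat; nra.
Qed.

(** With the noiseless leader [y], write [x - v] as [(y - v) + (x - y)]. The first part is
    [be_the_leader] in each coordinate; the second pairs the l1 bound on the gradients with a
    uniform bound on the drift. *)
Lemma noisy_leader_regret (n T : nat) H B (g N x : nat -> 'I_n -> R)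
    (D : nat -> R) (v : 'I_n -> R) : 0 < H -> (0 < T)%N ->
  (forall i, 0 <= x 1 i <= 1) -> (forall i, 0 <= v i <= 1) ->
  (forall t i, (1 <= t < T)%N -> x t.+1 i =
     clamp (- (\sum_(1 <= j < t.+1) g j i + N t i) / (H * t%:R))) ->
  (forall t, (1 <= t <= T)%N -> \sum_i `|g t i| <= B) ->
  (forall t, 0 <= D t) -> (forall t i, (1 <= t < T)%N -> `|N t i| <= D t) ->
  \sum_(1 <= t < T.+1) \sum_i g t i * (x t i - v i) <=
  H * T%:R * n%:R / 2 + B +
  \sum_(1 <= t < T) B * ((D t / t%:R + 2 * B / t.+1%:R) / H).
Proof.
move=> H0 T0 x1 v01 xE gB D0 ND.
pose y t i := clamp (- (\sum_(1 <= j < t.+1) g j i) / (H * t%:R)).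
have gBi t i : (1 <= t <= T)%N -> `|g t i| <= B.
  by move=> /gB; apply: le_trans; rewrite (bigD1 i) //= lerDl sumr_ge0.
have -> : \sum_(1 <= t < T.+1) \sum_i g t i * (x t i - v i) =
    \sum_(1 <= t < T.+1) \sum_i g t i * (y t i - v i) +
    \sum_(1 <= t < T.+1) \sum_i g t i * (x t i - y t i).
  rewrite -big_split; apply: eq_bigr => t _; rewrite -big_split; apply: eq_bigr => i _.
  by rewrite /=; ring.
rewrite -addrA lerD //.
  rewrite exchange_big /= -mulrA mulrC -mulrA mulr_natl -[n in leRHS]card_ord -sumr_const.
  apply: ler_sum => i _.
  have := @be_the_leader _ (g^~ i) (y^~ i) T _ H0 (v01 i) (fun=> erefl).
  rewrite !big_split /=.
  have : 0 <= \sum_(1 <= t < T.+1) H / 2 * y t i ^+ 2.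
    by apply: sumr_ge0 => t _; rewrite mulr_ge0 ?sqr_ge0 // divr_ge0 // ltW.
  rewrite sumr_const_nat subn1 /= => y0.
  under [X in _ -> X <= _]eq_bigr do rewrite mulrBr; rewrite sumrB.
  suff : H / 2 * v i ^+ 2 *+ T <= T%:R / 2 * H by rewrite -/y; lra.
  rewrite -mulr_natl (_ : _ / 2 * H = T%:R * (H / 2)); last by ring.
  rewrite ler_wpM2l ?ler0n //.
  rewrite -[leRHS]mulr1 ler_wpM2l ?divr_ge0 ?(ltW H0) //.
  by have := v01 i; nra.
have dot_le t (e : R) : (1 <= t <= T)%N -> (forall i, `|x t i - y t i| <= e) ->
    0 <= e -> \sum_i g t i * (x t i - y t i) <= B * e.
  move=> tT xye e0; apply: (@le_trans _ _ (\sum_i `|g t i| * e)).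
    apply: ler_sum => i _; apply: le_trans (ler_norm _) _.
    by rewrite normrM ler_wpM2l.
  by rewrite -mulr_suml ler_wpM2r // gB.
(* The initial point is arbitrary in the cube, at distance at most 1 from [y 1] in each coordinate:
   this is the term [B]. In later rounds the drift bound applies. *)
rewrite big_nat_recl //= lerD //.
  rewrite -[leRHS]mulr1; apply: dot_le => //.
  move=> i; have := x1 i; have := clamp_itv (- (\sum_(1 <= j < 2) g j i) / (H * 1%:R)).
  by rewrite ler_norml /y; lra.
rewrite big_nat [leRHS]big_nat; apply: ler_sum => t tT.
have tT' : (1 <= t.+1 <= T)%N by case/andP: tT.
have /andP[t1 _] := tT.
have drift i : `|x t.+1 i - y t.+1 i| <= (`|N t i| / t%:R + 2 * B / t.+1%:R) / H.
  rewrite xE //; apply: (leader_drift (N^~ i)) => //.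
  move=> j /andP[j1 jt]; apply: gBi; rewrite j1 /=.
  by apply: (leq_trans jt); case/andP: tT.
have B0 : 0 <= B by apply: le_trans (gB 1 _); rewrite ?sumr_ge0.
apply: dot_le => //; last first.
  by rewrite divr_ge0 ?(ltW H0) // addr_ge0 ?divr_ge0 ?mulr_ge0 ?ler0n ?D0.
move=> i; apply: le_trans (drift i) _.
by rewrite ler_wpM2r ?invr_ge0 ?(ltW H0) // lerD2r ler_wpM2r ?invr_ge0 ?ler0n ?ND.
Qed.

End follow_the_leader.

(** * Norm of the noise *)

Section dilation.
Context {R : realType}.
Local Notation mu := (@lebesgue_measure R).
Local Open Scope ereal_scope.
Import HBNNSimple.

(** The simple functions below [f] are also below [g], so the suprema compare without
    measurability. *)
Lemma ge0_le_integralT d (T : measurableType d) (nu : {measure set T -> \bar R})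
    (f g : T -> \bar R) : (forall x, 0 <= f x) -> (forall x, f x <= g x) ->
  \int[nu]_x f x <= \int[nu]_x g x.
Proof.
move=> f0 fg; have g0 x : 0 <= g x by apply: le_trans (fg x).
rewrite !ge0_integralTE //; apply: le_ereal_sup => _ [h hf <-].
by exists h => // x; apply: le_trans (fg x).
Qed.

(** [l] times the image measure agrees with Lebesgue measure on intervals, hence everywhere by
    uniqueness. *)
Lemma lebesgue_measure_scale (l : R) (A : set R) : (0 < l)%R -> measurable A ->
  mu ( *%R l @^-1` A) = (l^-1)%:E * mu A.
Proof.
move=> l0 mA; have ml : measurable_fun setT ( *%R l : measurableTypeR R -> measurableTypeR R).
  exact: mulrl_measurable.
have l0' : (0 <= l)%R by exact: ltW.
pose nu : {measure set (measurableTypeR R) -> \bar R} :=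
  mscale (NngNum l0') (pushforward mu ( *%R l : measurableTypeR R -> measurableTypeR R)).
rewrite (@lebesgue_measure_unique R (nu ml) _ A mA).
  rewrite /nu /mscale /= /pushforward muleA -EFinM mulVf ?mul1e ?gt_eqF //.
move=> _ [[a b] _ <-].
transitivity (l%:E * mu `](a / l)%R, (b / l)%R]%classic); last first.
  congr (_ * mu _); apply/seteqP; split=> x /=; rewrite !in_itv /=;
    by rewrite ltr_pdivrMr // ler_pdivlMr // [(x * l)%R]mulrC.
rewrite !lebesgue_measure_itv /= !lte_fin ltr_pM2r ?invr_gt0 //.
case: ifP => _; last by rewrite mule0.
by rewrite -EFinB -EFinM -mulrBl mulrCA divff ?mulr1 ?gt_eqF.
Qed.

(* No measurability is assumed, so that it applies under iterated integrals: the
   integral of a nonnegative function is a supremum over simple functions. *)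
Lemma integral_dilation_le (f g : R -> \bar R) (k l : R) : (0 < k)%R -> (0 < l)%R ->
  (forall x, 0 <= f x) -> (forall x, f x <= k%:E * g (l * x)%R) ->
  \int[mu]_x f x <= (k / l)%:E * \int[mu]_x g x.
Proof.
move=> k0 l0 f0 fg.
rewrite [leLHS]ge0_integralTE //; apply: ge_ereal_sup => _ [h hf <-].
(* Undoing the dilation turns a simple function below [f] into a measurable function below [g], to
   which the change of variables applies. *)
pose h' (x : R) := (k^-1 * h (l^-1 * x))%R.
have ml : measurable_fun setT ( *%R l^-1 : measurableTypeR R -> measurableTypeR R).
  exact: mulrl_measurable.
have hg x : (h' x)%:E <= g x.
  rewrite /h' EFinM lee_pdivrMl //.
  apply: le_trans (hf _) _.
  by apply: le_trans (fg _) _; rewrite mulrA mulfV ?mul1r ?gt_eqF.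
have h0 x : 0 <= (h' x)%:E by rewrite lee_fin mulr_ge0 // invr_ge0 ltW.
apply: (@le_trans _ _ ((k / l)%:E * \int[mu]_x (h' x)%:E)); last first.
  rewrite lee_wpmul2l ?lee_fin ?divr_ge0 ?(ltW k0) ?(ltW l0) //.
  exact: ge0_le_integralT.
have -> : sintegral mu h = \int[mu]_x (h x)%:E by rewrite integral_nnsfun // patch_setT.
under [in leRHS]eq_integral do rewrite EFinM.
rewrite ge0_integralZl //.
4: by rewrite lee_fin invr_ge0 ltW.
3: by move=> x _; rewrite lee_fin.
2: by apply/measurable_EFinP; exact: (measurableT_comp (measurable_funPT h) ml).
rewrite muleA -EFinM mulrAC mulfV ?mul1r ?gt_eqF //.
have := @ge0_integral_pushforward _ _ _ _ R _ ml mu setT (EFin \o h).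
rewrite preimage_setT => /(_ measurableT) /= <- //.
2: by apply: measurableT_comp => //; exact: measurable_funPT.
rewrite [in leRHS](@eq_measure_integral _ _ _ setT (mscale (NngNum (ltW l0)) mu)); last first.
  move=> A mA _; have := @lebesgue_measure_scale l^-1 A; rewrite invr_gt0 invrK.
  by move=> /(_ l0 mA) E; apply: etrans E _.
rewrite ge0_integral_mscale //; last first.
- by move=> x _; rewrite lee_fin.
- by apply/measurable_EFinP; exact: measurable_funPT.
  by rewrite muleA -EFinM mulVf ?mul1e ?gt_eqF.
by move=> x _; rewrite lee_fin.
Qed.

Lemma lebesgue_int_ge0 n (F : n.-tuple R -> \bar R) :
  (forall s, 0 <= F s) -> 0 <= lebesgue_int F.
Proof.
elim: n F => [|n IH] F F0 /=; first exact: F0.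
by apply: integral_ge0 => y _; apply: IH.
Qed.

(** Each coordinate contributes a factor [l^-1]; the constant [k] is general because the inner
    integral supplies the constant of the outer one. *)
Lemma lebesgue_int_dilation_le n (F G : n.-tuple R -> \bar R) (k l : R) :
  (0 < k)%R -> (0 < l)%R -> (forall s, 0 <= F s) ->
  (forall s, F s <= k%:E * G [tuple of map ( *%R l) s]) ->
  lebesgue_int F <= (k / l ^+ n)%:E * lebesgue_int G.
Proof.
elim: n F G k => [|n IH] F G k k0 l0 F0 FG /=.
  by rewrite expr0 divr1 (le_trans (FG _)) // (_ : [tuple of _] = [tuple]) //; exact: tuple0.
rewrite exprSr invfM mulrA; apply: integral_dilation_le => //.
- by rewrite divr_gt0 ?exprn_gt0.
- by move=> y; apply: lebesgue_int_ge0.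
move=> y; apply: IH => // s; apply: le_trans (FG _) _.
by rewrite (_ : [tuple of _] = cons_tuple (l * y)%R [tuple of map ( *%R l) s]) //; exact: val_inj.
Qed.

End dilation.

Section noise.
Context {R : realType}.
Implicit Types n : nat.

Lemma measurable_norm2_row_of n :
  measurable_fun [set: n.-tuple R] (fun s => norm2 (row_of s)).
Proof.
apply: (@measurableT_comp _ _ _ _ _ _ (@Num.sqrt R)).
  by apply: continuous_measurable_fun; exact: sqrt_continuous.
apply: measurable_sum => i; apply: measurable_funX.
under eq_fun do rewrite mxE; exact: measurable_tnth.
Qed.

Lemma norm2_ge0 n (x : 'rV[R]_n) : 0 <= norm2 x.
Proof. exact: sqrtr_ge0. Qed.

Lemma norm2_row_of_scale n (l : R) (s : n.-tuple R) : 0 <= l ->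
  norm2 (row_of [tuple of map ( *%R l) s]) = l * norm2 (row_of s).
Proof.
move=> l0; rewrite /norm2 -[l in RHS](ger0_norm l0) -sqrtr_sqr -sqrtrM ?sqr_ge0 //.
congr Num.sqrt; rewrite mulr_sumr; apply: eq_bigr => i _.
by rewrite !mxE tnth_map exprMn.
Qed.

Lemma ler_coord_norm2 n (x : 'rV[R]_n) i : `|x ord0 i| <= norm2 x.
Proof.
rewrite -sqrtr_sqr ler_wsqrtr // (bigD1 i) //= lerDl sumr_ge0 // => j _.
exact: sqr_ge0.
Qed.

Context d (Omega : measurableType d) (P : probability Omega R).

(* The dilation s |-> s / 2 compares the tail of the kernel with its total mass. *)
Lemma exp_norm_tail n (X : Omega -> n.-tuple R) (b r : R) : 0 < b ->
  has_density_prop_to P X (fun s => expR (- (norm2 (row_of s) * b))) ->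
  (P (X @^-1` [set s : n.-tuple R | (r <= norm2 (row_of s))%R]) <= (2 ^+ n * expR (- (b * r / 2)))%:E)%E.
Proof.
move=> b0 [c cP]; set A := [set s | _].
have mA : measurable A.
  rewrite -[A]setTI; have := @measurable_norm2_row_of n; rewrite /A.
  rewrite (_ : [set s : n.-tuple R | _] = (fun s => norm2 (row_of s)) @^-1` `[r, +oo[).
    by apply=> //; exact: measurable_itv.
  by apply/seteqP; split=> s /=; rewrite in_itv /= andbT.
rewrite cP //; set LA := lebesgue_int _.
have := cP setT measurableT; rewrite preimage_setT probability_setT; set LT := lebesgue_int _ => cLT.
have LT0 : (0 <= LT)%E.
  by apply: lebesgue_int_ge0 => s; rewrite lee_fin mulr_ge0 ?expR_ge0.
(* A negative constant would make the total mass nonpositive, whereas it is 1. *)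
have c0 : 0 <= c.
  rewrite leNgt; apply/negP => c0.
  have : (c%:E * LT <= 0)%E by rewrite mule_le0_ge0 // lee_fin ltW.
  by rewrite -cLT lee_fin ler10.
(* Where [r <= u], half of the exponent [b * u] is at least [b * r / 2]; the other half is the
   kernel at the halved point, so [l] is [2^-1]. *)
have LAT : (LA <= (expR (- (b * r / 2)) / 2^-1 ^+ n)%:E * LT)%E.
  apply: lebesgue_int_dilation_le; rewrite ?expR_gt0 ?invr_gt0 // => s.
  rewrite -EFinM lee_fin norm2_row_of_scale ?invr_ge0 //.
  rewrite !indicE in_setT mulr1 -expRD.
  have [/set_mem /= sA|] := boolP (s \in A); last by rewrite mulr0 expR_ge0.
  rewrite mulr1 ler_expR; set u := norm2 _ in sA *.
  by have : b * r <= b * u; [rewrite ler_wpM2l // ltW|lra].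
apply: (le_trans (lee_wpmul2l _ LAT)); first by rewrite lee_fin.
by rewrite muleCA -cLT mule1 exprVn invrK mulrC.
Qed.

(** The tail bound is summed over levels spaced by [2 / b], starting at [2 * n%:R / b], where the
    exponential begins to beat [2 ^+ n]. *)
Lemma exp_norm_expectation n (X : {RV P >-> n.-tuple R}) (b : R) : (0 < n)%N -> 0 < b ->
  has_density_prop_to P X (fun s => expR (- (norm2 (row_of s) * b))) ->
  (\int[P]_w (norm2 (row_of (X w)))%:E <= (6 * n%:R / b)%:E)%E.
Proof.
move=> n0 b0 PX; set Y := fun w => norm2 (row_of (X w)).
(* Chosen so that [b * r k / 2 = n + k]: [exp (- n)] absorbs [2 ^+ n] and [exp (- k)] is at most
   [2 ^- k]. *)
pose r k : R := 2 * n%:R / b + 2 / b * k%:R.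
pose A k := X @^-1` [set s : n.-tuple R | r k <= norm2 (row_of s)].
have mA k : measurable (A k).
  have mY : measurable_fun setT Y.
    by apply: (measurableT_comp (@measurable_norm2_row_of n)); exact: measurable_funPT.
  rewrite (_ : A k = Y @^-1` `[r k, +oo[).
    by rewrite -[X in measurable X]setTI; apply: mY => //; exact: measurable_itv.
  by apply/seteqP; split=> w /=; rewrite in_itv /= andbT.
have PA k : (P (A k) <= (2 / (2 ^ k.+1)%:R)%:E)%E.
  apply: le_trans (exp_norm_tail _ b0 PX) _; rewrite lee_fin.
  have -> : b * r k / 2 = n%:R + k%:R by rewrite /r; field; rewrite gt_eqF.
  have e2 m : expR (- m%:R) <= (2 ^+ m)^-1 :> R.
    rewrite expRN lef_pV2 ?posrE ?expR_gt0 ?exprn_gt0 //.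
    rewrite -[m%:R]mulr1 mulrC expRM_natr.
    by apply: lerXn2r; rewrite ?nnegrE ?expR_ge0 // (le_trans _ (expR_ge1Dx _)) //; lra.
  rewrite opprD expRD mulrA natrX exprS invfM mulrA divff ?mul1r ?pnatr_eq0 //.
  rewrite -[leRHS]mul1r ler_pM ?mulr_ge0 ?expR_ge0 ?exprn_ge0 //.
  by rewrite -ler_pdivlMl ?exprn_gt0 // mulr1.
have d0 : 0 <= 2 / b by rewrite divr_ge0 // ltW.
have I0 k w : (0 <= (2 / b * \1_(A k) w)%:E)%E by rewrite lee_fin mulr_ge0.
apply: (@le_trans _ _ (\int[P]_w ((2 * n%:R / b)%:E +
    \sum_(0 <= k <oo) (2 / b * \1_(A k) w)%:E)))%E.
  apply: ge0_le_integralT => w; first by rewrite lee_fin norm2_ge0.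
  rewrite -[norm2 _]/(Y w); have [Yr|rY] := leP (Y w) (2 * n%:R / b).
    by rewrite -[leLHS]adde0 leeD ?lee_fin // nneseries_ge0.
  (* [m] full steps fit between the starting level and [Y w], so the indicators of index 0 to [m]
     all equal 1 and their [m.+1] steps cover the excess. *)
  pose m := Num.truncn ((Y w - 2 * n%:R / b) / (2 / b)).
  have db : 0 < 2 / b by rewrite divr_gt0.
  have /andP[m1 m2] : m%:R <= (Y w - 2 * n%:R / b) / (2 / b) < m.+1%:R.
    by apply: truncn_itv; rewrite divr_ge0 // subr_ge0 ltW.
  rewrite ler_pdivlMr // in m1; rewrite ltr_pdivrMr // in m2.
  apply: (@le_trans _ _ ((2 * n%:R / b)%:E + \sum_(0 <= k < m.+1) (2 / b * \1_(A k) w)%:E))%E.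
    rewrite sumEFin -EFinD lee_fin big_nat (eq_bigr (fun=> 2 / b)) => [|k /andP[_ km]].
      by rewrite -big_nat sumr_const_nat subn0 -mulr_natl; lra.
    rewrite indicE mem_set ?mulr1 // /A /= /r -/(Y w).
    have : k%:R <= m%:R :> R by rewrite ler_nat.
    by move: m1; set K := k%:R; set Mm := m%:R; set q := 2 / b in db *; nra.
  by rewrite leeD2l // nneseries_lim_ge.
have mI k : measurable_fun setT (fun w => (2 / b * \1_(A k) w)%:E).
  by apply/measurable_EFinP; apply: measurable_funM => //; exact: measurable_indic.
rewrite ge0_integralD //=; last 3 first.
- by move=> w _; rewrite lee_fin divr_ge0 ?mulr_ge0 // ltW.
- by move=> w _; apply: nneseries_ge0.
- by apply: ge0_emeasurable_sum.
rewrite (_ : (\int[P]__ _)%E = (2 * n%:R / b)%:E); last first.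
  by rewrite integral_cst // -[RHS]mule1; congr (_ * _)%E; exact: (probability_setT P).
rewrite integral_nneseries //.
apply: (@le_trans _ _ ((2 * n%:R / b)%:E +
    \sum_(0 <= k <oo) ((4 / b) / (2 ^ k.+1)%:R)%:E))%E.
  rewrite leeD2l //; apply: lee_nneseries => [k _ _|k _].
    by apply: integral_ge0 => w _.
  under eq_integral do rewrite EFinM.
  rewrite ge0_integralZl ?lee_fin //; last first.
  - by apply/measurable_EFinP; exact: measurable_indic.
  rewrite integral_indic // setIT; apply: le_trans (lee_wpmul2l _ (PA k)) _ => //.
  rewrite -EFinM lee_fin; lra.
(* The geometric series sums to [4 / b], which is at most [4 * n%:R / b] since [n] is positive. *)
apply: (@le_trans _ _ ((2 * n%:R / b)%:E + (4 / b)%:E))%E.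
  by rewrite leeD2l // epsilon_trick0 // divr_ge0 // ltW.
rewrite -EFinD lee_fin; have : 1 <= n%:R :> R by rewrite ler1n.
have : 0 < b^-1 by rewrite invr_gt0.
by set N := n%:R; set B := b^-1; nra.
Qed.

End noise.

(** * The update rule *)

Section run.
Context {R : realType} {n : nat}.

Lemma norm2_sqr (x : 'rV[R]_n) : norm2 x ^+ 2 = \sum_i x ord0 i ^+ 2.
Proof. by rewrite sqr_sqrtr // sumr_ge0 // => i _; exact: sqr_ge0. Qed.

(** Expanding the squares leaves a constant plus one parabola per coordinate, with linear
    coefficient [a i]. *)
Lemma argmin_clamp (H : R) (t : nat) (v : 'rV[R]_n) (xs : nat -> 'rV[R]_n)
    (z : 'rV[R]_n) : 0 < H -> (0 < t)%N ->
  is_argmin (@cube R n)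
    (fun y => dotv v y + H / 2 * \sum_(1 <= j < t.+1) norm2 (y - xs j) ^+ 2) z ->
  forall i, z ord0 i =
    clamp (- (v ord0 i - H * \sum_(1 <= j < t.+1) xs j ord0 i) / (H * t%:R)).
Proof.
move=> H0 t0 [Kz zmin] i; pose a i := v ord0 i - H * \sum_(1 <= j < t.+1) xs j ord0 i.
have Ht : 0 < H * t%:R by rewrite mulr_gt0 // ltr0n.
pose c := \row_i clamp (- a i / (H * t%:R)) : 'rV[R]_n.
have FE y : dotv v y + H / 2 * \sum_(1 <= j < t.+1) norm2 (y - xs j) ^+ 2 =
    \sum_i (a i * y ord0 i + H * t%:R / 2 * y ord0 i ^+ 2) +
    H / 2 * \sum_(1 <= j < t.+1) norm2 (xs j) ^+ 2.
  rewrite (eq_bigr (fun j => \sum_i (y ord0 i ^+ 2 - 2 * (y ord0 i * xs j ord0 i)) +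
      norm2 (xs j) ^+ 2)) => [|j _]; last first.
    by rewrite !norm2_sqr -big_split; apply: eq_bigr => k _; rewrite !mxE /=; ring.
  rewrite big_split mulrDr addrA; congr (_ + _).
  rewrite exchange_big mulr_sumr -big_split; apply: eq_bigr => k _ /=.
  by rewrite sumrB sumr_const_nat subn1 /= -!mulr_sumr -mulr_natr /a; field.
have Kc : @cube R n c by rewrite /cube /= => j; rewrite mxE clamp_itv.
have := zmin c Kc; rewrite !FE lerD2r => zc.
(* Both [z] and [c] are minimisers, so the strong convexity gap between them must vanish. *)
have dev : \sum_i (H * t%:R / 2 * (z ord0 i - c ord0 i) ^+ 2) <= 0.
  have : \sum_i (a i * c ord0 i + H * t%:R / 2 * c ord0 i ^+ 2) +
      \sum_i (H * t%:R / 2 * (z ord0 i - c ord0 i) ^+ 2) <=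
      \sum_i (a i * z ord0 i + H * t%:R / 2 * z ord0 i ^+ 2).
    by rewrite -big_split; apply: ler_sum => j _; rewrite mxE; apply: clamp_argmin => //; exact: Kz.
  by move: zc; set A := \sum_i _; set B := \sum_i _; set C := \sum_i _; lra.
have pos j : true -> 0 <= H * t%:R / 2 * (z ord0 j - c ord0 j) ^+ 2.
  by move=> _; rewrite mulr_ge0 ?sqr_ge0 // divr_ge0 // ltW.
have /eqP : \sum_i (H * t%:R / 2 * (z ord0 i - c ord0 i) ^+ 2) = 0.
  by apply/eqP; rewrite eq_le dev sumr_ge0.
rewrite psumr_eq0 // => /allP /(_ i); rewrite mem_index_enum => /(_ isT) /=.
rewrite mulf_eq0 sqrf_eq0 gt_eqF ?divr_gt0 //= subr_eq0 => /eqP ->.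
by rewrite mxE.
Qed.

Definition cover_noise T (leaf_noise : bool) (noise : node T -> 'rV[R]_n)
    (N : {set node T}) : 'rV[R]_n :=
  \sum_(u in N) (if leaf_noise || (0 < tag u)%N then noise u else 0).

(** After exchanging sums, [z s] is counted once per node of [N] above leaf [s]: once if [s <= t],
    never otherwise. *)
Lemma tbap_outputE T (leaf_noise : bool) (noise : node T -> 'rV[R]_n)
    (t : nat) (N : {set node T}) (z : nat -> 'rV[R]_n) : (t <= T)%N ->
  tbap_cover t N ->
  tbap_output leaf_noise noise N z =
  \sum_(1 <= s < t.+1) z s + cover_noise leaf_noise noise N.
Proof.
move=> tT [_ Ncov]; rewrite /tbap_output /noisy_value big_split; congr (_ + _).
rewrite (exchange_big_dep xpredT) //=.
have H s : (1 <= s < T.+1)%N ->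
    \sum_(u in N | in_subtree u s) z s = (s <= t)%N%:R *: z s.
  move=> /andP[s1 sT]; rewrite sumr_const -scaler_nat; congr (_%:R *: _).
  rewrite -Ncov; last by rewrite s1 /= (leq_trans (sT : (s <= T)%N)) // up_logP.
  by apply: eq_card => u; rewrite !inE.
rewrite big_nat (eq_bigr _ H) -big_nat (big_cat_nat (n := t.+1)) //=.
rewrite [X in _ + X]big_nat [X in _ + X]big1 ?addr0 => [|s /andP[ts _]]; last first.
  by rewrite leqNgt ts scale0r.
rewrite big_nat [RHS]big_nat; apply: eq_bigr => s /andP[_ st].
by rewrite -ltnS st scale1r.
Qed.

Lemma cover_noise_le T (leaf_noise : bool) (noise : node T -> 'rV[R]_n)
    (N : {set node T}) i :
  `|cover_noise leaf_noise noise N ord0 i| <= \sum_(u in N) norm2 (noise u).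
Proof.
rewrite /cover_noise summxE; apply: le_trans (ler_norm_sum _ _ _) _.
apply: ler_sum => u _; case: ifP => _; first exact: ler_coord_norm2.
by rewrite mxE normr0 norm2_ge0.
Qed.

End run.

(** * Independence of the iterates and the thresholds *)

Section independence.
Context {R : realType} d (Omega : measurableType d) (P : probability Omega R).
Context n (T : nat) (gam : node T -> {RV P >-> n.-tuple R}) (tau : nat -> {RV P >-> R}).

(** The pi-system of cylinder events. The sigma-algebra it generates expresses dependence on the
    noises alone. *)
Definition noise_events : set (set Omega) :=
  [set E | exists2 A : node T -> set (n.-tuple R),
    (forall v, measurable (A v)) & E = \bigcap_v (gam v @^-1` A v)].

Lemma noise_eventsI : setI_closed noise_events.
Proof.
move=> _ _ [A mA ->] [B mB ->]; exists (fun v => A v `&` B v).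
  by move=> v; apply: measurableI.
by rewrite -bigcapI; apply: eq_bigcapr.
Qed.

Lemma noise_eventsT : noise_events setT.
Proof.
exists (fun=> setT) => //; apply/seteqP; split=> // w _ v _ //.
Qed.

Lemma measurable_noise_events : noise_events `<=` measurable.
Proof.
move=> _ [A mA ->]; apply: fin_bigcap_measurable => [|v _]; first exact: finite_finset.
by rewrite -[X in measurable X]setTI; exact: measurable_funPT.
Qed.

Lemma measurable_sigma_noise_events E : <<s noise_events >> E -> measurable E.
Proof. exact: smallest_sub (@sigma_algebra_measurable _ Omega) measurable_noise_events _. Qed.

Lemma measurable_gam v : measurable_fun setT (gam v : g_sigma_algebraType noise_events -> _).
Proof.
move=> _ A mA; rewrite setTI; apply: sub_sigma_algebra.
exists (fun u => if u == v then A else setT); first by move=> u; case: ifP.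
apply/seteqP; split=> w /=.
  by move=> Aw u _; rewrite /=; case: eqP => [->|].
by move=> /(_ v I) /=; rewrite eqxx.
Qed.

Hypothesis indep : mutually_independent gam tau.

(** Both sides are finite measures in [E] that agree on the cylinders, hence on the generated
    sigma-algebra. *)
Lemma noise_events_indep t (B : set R) E : (2 <= t <= T.+1)%N -> measurable B ->
  <<s noise_events >> E -> P (E `&` tau t @^-1` B) = (P E * P (tau t @^-1` B))%E.
Proof.
move=> tT mB; have mt : measurable (tau t @^-1` B).
  by rewrite -[X in measurable X]setTI; exact: measurable_funPT.
have pf : P (tau t @^-1` B) \is a fin_num by exact: fin_num_measure.
pose q := NngNum (fine_ge0 (measure_ge0 P (tau t @^-1` B))).
have qE : (q%:num)%:E = P (tau t @^-1` B) by rewrite -[RHS]fineK.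
have -> : (P E * P (tau t @^-1` B) = mscale q P E)%E by rewrite /mscale qE muleC.
apply: (@g_sigma_algebra_measure_unique _ _ _ noise_events _ (fun=> setT) _ _
  (mrestr P mt) (mscale q P)).
- exact: measurable_noise_events.
- by move=> _; exact: noise_eventsT.
- by apply/seteqP; split=> // w _; exists 0%N.
- exact: noise_eventsI.
- move=> _ [A mA ->].
  (* Constraining only the threshold of round [t] reduces the product over rounds to one factor; the
     case of a full [B'] identifies the remaining product with the probability of the cylinder. *)
  have EB (B' : set R) : \bigcap_(s in [set s | (2 <= s <= T.+1)%N])
      (tau s @^-1` (if s == t then B' else setT)) = tau t @^-1` B'.
    apply/seteqP; split=> w /=; first by move=> /(_ t tT) /=; rewrite eqxx.
    by move=> Bw s _ /=; case: eqP => [->|].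
  have mB' (B' : set R) : measurable B' -> forall s, measurable (if s == t then B' else setT).
    by move=> ? s; case: ifP.
  have PB' (B' : set R) : (\prod_(2 <= s < T.+2) P (tau s @^-1` (if s == t then B' else setT)) =
      P (tau t @^-1` B'))%E.
    rewrite (bigD1_seq t) ?iota_uniq ?mem_index_iota //= eqxx big1 ?mule1 // => s /negbTE ->.
    by rewrite preimage_setT probability_setT.
  have := indep mA (mB' _ mB); rewrite EB PB' => E1; apply: (etrans E1).
  have := indep mA (mB' _ measurableT).
  rewrite EB PB' preimage_setT setIT probability_setT mule1 => E2.
  rewrite -E2 -qE; exact: muleC.
- move=> _; have fin : (P (setT `&` tau t @^-1` B) < +oo)%E by rewrite setTI -ge0_fin_numE.
  exact: fin.
Qed.

Lemma uniform_prob_lt (v : R) : 0 <= v <= 1 ->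
  uniform_prob (@ltr01 R) [set r | r < v] = v%:E.
Proof.
move=> /andP[v0 v1]; rewrite /uniform_prob integral_uniform_pdf.
rewrite (_ : [set r | r < v] `&` `[0, 1] = `[0, v[%classic); last first.
  apply/seteqP; split=> r /=; rewrite !in_itv /=; first by move=> [-> /andP[->]].
  by move=> /andP[r0 rv]; rewrite rv r0; split => //; rewrite ltW // (lt_le_trans rv).
rewrite (eq_integral (fun=> 1%E)); last first.
  move=> r /set_mem /=; rewrite in_itv /= => /andP[r0 rv].
  by rewrite /uniform_pdf r0 (ltW (lt_le_trans rv v1)) /= subr0 invr1.
rewrite integral_cst // mul1e; apply: (etrans (lebesgue_measure_itv _)).
rewrite /= lte_fin.
by case: ltP => [|v0']; rewrite ?sube0 //; congr EFin; lra.
Qed.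

Hypothesis tauU : forall t, (2 <= t <= T.+1)%N -> forall A : set R, measurable A ->
  P (tau t @^-1` A) = uniform_prob (@ltr01 R) A.

Lemma sigma_noise_measurable_fun (V : Omega -> R) :
  measurable_fun setT (V : g_sigma_algebraType noise_events -> R) ->
  measurable_fun setT V.
Proof.
by move=> mV _ B mB; apply: measurable_sigma_noise_events; exact: mV.
Qed.

(** By independence the joint law of [V] and [tau t] is a product; its section at [v] is a half-line
    of uniform probability [v]. *)
Lemma threshold_prob t (V : Omega -> R) : (2 <= t <= T.+1)%N ->
  measurable_fun setT (V : g_sigma_algebraType noise_events -> R) ->
  (forall w, 0 <= V w <= 1) ->
  P [set w | tau t w < V w] = (\int[P]_w (V w)%:E)%E.
Proof.
move=> tT mV V01; have mV' := sigma_noise_measurable_fun mV.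
pose VM : {mfun Omega >-> R} := HB.pack V (isMeasurableFun.Build _ _ _ _ _ mV').
have mVt : measurable_fun setT (fun w => (V w, tau t w)).
  by apply: measurable_fun_pair => //; exact: measurable_funPT.
have mlt : measurable [set p : R * R | p.2 < p.1].
  have := @measurable_fun_ltr _ (R * R)%type R setT snd fst measurable_snd measurable_fst.
  by move=> /(_ measurableT [set true]); rewrite setTI; apply.
pose VT : {mfun Omega >-> (R * R)%type} := HB.pack (fun w => (V w, tau t w))
  (isMeasurableFun.Build _ _ _ _ _ mVt).
have <- : ((distribution P VM) \x (distribution P (tau t)))%E [set p | p.2 < p.1] =
    P [set w | tau t w < V w].
  have U := @product_measure_unique _ _ _ _ R (distribution P VM)
    (distribution P (tau t)) (distribution P VT).
  apply: (etrans (U _ _ mlt)) => //.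
  move=> A B mA mB; rewrite -noise_events_indep //.
  by have := mV measurableT A mA; rewrite setTI.
pose F := distribution P (tau t) \o xsection [set p : R * R | p.2 < p.1].
have FE v : F v = distribution P (tau t) [set r | r < v].
  rewrite /F /=; congr (distribution P (tau t) _).
  by apply/seteqP; split=> r /=; rewrite /xsection /= inE.
have mF : measurable_fun setT F by exact: measurable_fun_xsection.
have F0 v : (0 <= F v)%E by exact: measure_ge0.
apply: (etrans (@ge0_integral_distribution _ _ _ _ _ P VM F mF F0)).
apply: eq_integral => w _; rewrite [LHS]FE -(uniform_prob_lt (V01 w)) -(tauU tT) //.
by have := @measurable_itv R `]-oo, V w[; rewrite set_itvE.
Qed.

(** [threshold_prob] is applied to [\1_E * V]: outside [E] the event becomes [tau t < 0], which is
    null. *)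
Lemma threshold_prob_event t (E : set Omega) (V : Omega -> R) : (2 <= t <= T.+1)%N ->
  <<s noise_events >> E ->
  measurable_fun setT (V : g_sigma_algebraType noise_events -> R) ->
  (forall w, 0 <= V w <= 1) ->
  P (E `&` [set w | tau t w < V w]) = (\int[P]_w (\1_E w * V w)%:E)%E.
Proof.
move=> tT sE mV V01.
have mE := measurable_sigma_noise_events sE.
have mtau (W : Omega -> R) : measurable_fun setT W -> measurable [set w | tau t w < W w].
  move=> mW; have := @measurable_fun_ltr _ Omega R setT (tau t) W (measurable_funPT _) mW.
  by move=> /(_ measurableT [set true]); rewrite setTI; apply.
rewrite -(@threshold_prob t (fun w => \1_E w * V w)) //; first last.
- by move=> w; rewrite indicE; case: (_ \in _); rewrite ?mul1r ?mul0r ?lexx ?ler01.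
- by apply: measurable_funM => //; exact: measurable_indic.
have -> : [set w | tau t w < \1_E w * V w] =
    (E `&` [set w | tau t w < V w]) `|` (~` E `&` [set w | tau t w < 0]).
  apply/seteqP; split=> w /=; rewrite indicE.
    have [/set_mem Ew|/negP/negP] := boolP (w \in E); first by rewrite mul1r; left.
    by rewrite notin_setE mul0r; right.
  by move=> [[Ew]|[Ew]]; rewrite ?(mem_set Ew) ?(memNset Ew) ?mul1r ?mul0r.
rewrite measureU //; last 3 first.
- by apply: measurableI => //; apply: mtau; exact: sigma_noise_measurable_fun.
- by apply: measurableI; [exact: measurableC|apply: mtau].
- by apply/seteqP; split=> // w /= [[Ew _] [/(_ Ew)]].
rewrite [X in (_ + X)%E](_ : _ = 0%E) ?adde0 //.
apply/eqP; rewrite -measure_le0.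
have <- : P [set w | tau t w < 0] = 0%E.
  rewrite (@threshold_prob t (cst 0)) //; first by rewrite integral0.
  by move=> w; rewrite lexx ler01.
apply: le_measure; rewrite ?inE.
- by apply: measurableI; [exact: measurableC|apply: mtau].
- exact: mtau.
- by move=> w [].
Qed.

End independence.

(** * Expected regret *)

Section centered.
Context {R : realType} d (Omega : measurableType d) (P : probability Omega R).

Lemma bounded_integrable (X : Omega -> R) (C : R) : measurable_fun setT X ->
  (forall w, `|X w| <= C) -> P.-integrable setT (EFin \o X).
Proof.
move=> mX XC; apply: (@le_integrable _ _ _ P _ measurableT _ (cst C%:E)).
- exact/measurable_EFinP.
- by move=> w _ /=; rewrite lee_fin (le_trans (XC w)) // ler_norm.
- exact: finite_measure_integrable_cst.
Qed.

Definition centered (X : Omega -> R) :=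
  P.-integrable setT (EFin \o X) /\ (\int[P]_w (X w)%:E = 0)%E.

Lemma centered_sum (I : Type) (s : seq I) (X : I -> Omega -> R) :
  (forall i, centered (X i)) -> centered (fun w => \sum_(i <- s) X i w).
Proof.
move=> cX; elim: s => [|i s [IHi IH0]].
  rewrite (_ : (fun w => _) = cst 0); last by apply/funext => w; rewrite big_nil.
  by split; [exact: integrable0|exact: integral0].
rewrite (_ : (fun w => _) = (fun w => X i w + \sum_(j <- s) X j w)); last first.
  by apply/funext => w; rewrite big_cons.
have [iX X0] := cX i; split; first exact: (integrableD _ iX IHi).
by apply: (etrans (integralD_EFin measurableT iX IHi)); rewrite /= X0 IH0 adde0.
Qed.

Lemma centeredZ (c : R) (X : Omega -> R) : centered X -> centered (fun w => c * X w).
Proof.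
move=> [iX X0]; split; first exact: (integrableZl measurableT c iX).
by apply: (etrans (integralZl measurableT iX c)); rewrite X0 mule0.
Qed.

(** The positive part grows and the negative part shrinks, so the regret can be bounded pointwise
    under the integral. *)
Lemma le_integralT (f g : Omega -> \bar R) :
  (forall w, f w <= g w)%E -> (\int[P]_w f w <= \int[P]_w g w)%E.
Proof.
move=> fg; rewrite integralE [leRHS]integralE; apply: leeB.
- by apply: ge0_le_integralT => // w; rewrite !funeposE ge_max !le_max fg lexx orbT.
- by apply: ge0_le_integralT => // w; rewrite !funenegE ge_max !le_max leeN2 fg lexx orbT.
Qed.

(** Integrability accompanies the bound so that such bounds combine linearly. *)
Definition mean_le (X : Omega -> R) (C : R) :=
  P.-integrable setT (EFin \o X) /\ (\int[P]_w (X w)%:E <= C%:E)%E.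

Lemma mean_le_centered (X : Omega -> R) : centered X -> mean_le X 0.
Proof. by move=> [iX X0]; split => //; rewrite X0. Qed.

Lemma mean_le_cst (c : R) : mean_le (cst c) c.
Proof.
split; first exact: finite_measure_integrable_cst.
rewrite /= integral_cst // [X in (_ * X)%E](_ : _ = 1%E) ?mule1 //.
exact: (probability_setT P).
Qed.

Lemma mean_leD (X Y : Omega -> R) (C D : R) : mean_le X C -> mean_le Y D ->
  mean_le (fun w => X w + Y w) (C + D).
Proof.
move=> [iX XC] [iY YD]; split; first exact: (integrableD _ iX iY).
have -> := integralD_EFin measurableT iX iY.
by rewrite EFinD leeD.
Qed.

Lemma mean_leZ (c : R) (X : Omega -> R) (C : R) : 0 <= c -> mean_le X C ->
  mean_le (fun w => c * X w) (c * C).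
Proof.
move=> c0 [iX XC]; split; first exact: (integrableZl measurableT c iX).
have -> := integralZl measurableT iX c.
by rewrite EFinM lee_wpmul2l // lee_fin.
Qed.

Lemma mean_le_sum (I : eqType) (s : seq I) (Q : pred I) (X : I -> Omega -> R) (C : I -> R) :
  (forall i, Q i -> mean_le (X i) (C i)) ->
  mean_le (fun w => \sum_(i <- s | Q i) X i w) (\sum_(i <- s | Q i) C i).
Proof.
move=> cX; elim: s => [|i s IH].
  rewrite big_nil (_ : (fun w => _) = cst 0); first exact: mean_le_cst.
  by apply/funext => w; rewrite big_nil.
under eq_fun do rewrite big_cons; rewrite big_cons.
by have [Qi|//] := boolP (Q i); apply: mean_leD => //; exact: cX.
Qed.

End centered.

Lemma measurable_rule (R : realType) n d (Omega : measurableType d)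
    (X : Omega -> 'rV[R]_n) (r : 'rV[R]_n -> {perm 'I_n}) pi :
  (forall i, measurable_fun setT (fun w => X w ord0 i)) -> chain_rule r ->
  measurable [set w | r (X w) = pi].
Proof.
move=> mX [_ mr]; pose Y w := [tuple X w ord0 i | i < n].
have mY : measurable_fun setT Y.
  apply/measurable_fun_tnthP => i; rewrite (_ : _ \o _ = fun w => X w ord0 i) //.
  by apply/funext => w /=; rewrite tnth_mktuple.
have := mY measurableT _ (mr pi); rewrite setTI; congr (measurable _).
apply/seteqP; split=> w /=; rewrite (_ : row_of (Y w) = X w) //;
  by apply/rowP => i; rewrite mxE tnth_mktuple.
Qed.

Lemma measurable_clamp (R : realType) d (Omega : measurableType d) (X : Omega -> R) :
  measurable_fun setT X -> measurable_fun setT (fun w => clamp (X w)).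
Proof.
move=> mX; apply: (@measurable_maxr _ _ _ setT (cst 0) (fun w => Num.min (X w) 1)) => //.
exact: (@measurable_minr _ _ _ setT X (cst 1)).
Qed.

(** * Iterates, sampling error and regret of a run *)

Section pftal_run.
Context {R : realType} d (Omega : measurableType d) (P : probability Omega R).
Context n (T : nat) (f : nat -> {set 'I_n} -> R) (H L eps : R) (leaf_noise : bool).
Context (cover : nat -> {set node T}) (rule : nat -> 'rV[R]_n -> {perm 'I_n}).
Context (S1 : {set 'I_n}) (gam : node T -> {RV P >-> n.-tuple R}).
Context (tau : nat -> {RV P >-> R}) (x : nat -> Omega -> 'rV[R]_n).
Context (S : nat -> Omega -> {set 'I_n}).
Hypothesis run : submod_pftal f H L eps leaf_noise cover rule S1 gam tau x S.
Hypothesis H0 : 0 < H.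

Let g t w := lovasz_grad (f t) (rule t (x t w)).
Let noise t w := cover_noise leaf_noise (fun u => row_of (gam u w)) (cover t).

(** The terms [H *: x s w] fed to the tree cancel the linear part of the quadratic regulariser. *)
Lemma iterateE t w i : (1 <= t <= T)%N -> x t.+1 w ord0 i =
  clamp (- (\sum_(1 <= j < t.+1) g j w ord0 i + noise t w ord0 i) / (H * t%:R)).
Proof.
move=> tT; have /andP[t1 tleT] := tT.
have := pftal_x run w tT => /= /(argmin_clamp H0 t1) ->; congr (clamp (- _ / _)).
rewrite (tbap_outputE _ _ _ tleT (pftal_cover run tT)) mxE summxE -/(noise t w).
rewrite addrAC; congr (_ + _); apply/eqP; rewrite subr_eq; apply/eqP.
by rewrite mulr_sumr -big_split; apply: eq_bigr => j _; rewrite !mxE.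
Qed.

Lemma iterate_cube t w : (1 <= t <= T.+1)%N -> cube (x t w).
Proof.
case: t => // -[_|t tT] i; last by rewrite iterateE // clamp_itv.
by rewrite (pftal_x1 run) mxE; case: (_ \in _); rewrite ?lexx ?ler01.
Qed.

Local Notation noise_type := (g_sigma_algebraType (noise_events gam)).

Lemma measurable_iterate_step t : (1 <= t <= T)%N ->
  (forall i, measurable_fun setT ((fun w => x t w ord0 i) : noise_type -> R)) ->
  forall pi, <<s noise_events gam >> [set w | rule t (x t w) = pi].
Proof.
move=> tT mx pi.
exact: (@measurable_rule R n _ noise_type (x t) (rule t) pi mx (pftal_rule run tT)).
Qed.

(** A finite expansion over chains, which reduces measurability and means of the subgradient to the
    events where a chain is selected. *)
Lemma gradE t w i : g t w ord0 i = \sum_(pi : {perm 'I_n})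
  lovasz_grad (f t) pi ord0 i * \1_[set w | rule t (x t w) = pi] w.
Proof.
rewrite (bigD1 (rule t (x t w))) //= indicE mem_set // mulr1 big1 ?addr0 // => pi.
by move=> /eqP pin; rewrite indicE memNset ?mulr0 // => /= pE; apply: pin.
Qed.

Lemma measurable_grad_step t i : (1 <= t <= T)%N ->
  (forall i, measurable_fun setT ((fun w => x t w ord0 i) : noise_type -> R)) ->
  measurable_fun setT ((fun w => g t w ord0 i) : noise_type -> R).
Proof.
move=> tT mx; under eq_fun do rewrite gradE.
apply: measurable_sum => pi; apply: measurable_funM => //.
exact: (@measurable_indic _ noise_type R setT _ (measurable_iterate_step tT mx pi)).
Qed.

(** By strong induction: an iterate is built from earlier subgradients and tree noises, and
    thresholds never enter it. *)
Lemma measurable_iterate t : (1 <= t <= T.+1)%N ->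
  forall i, measurable_fun setT ((fun w => x t w ord0 i) : noise_type -> R).
Proof.
elim/ltn_ind: t => -[|[|t]] IH tT i //.
  rewrite (_ : (fun w => _) = cst (charvec R S1 ord0 i)) //.
  by apply/funext => w; rewrite (pftal_x1 run).
rewrite (_ : (fun w => _) = (fun w => clamp (- (\sum_(1 <= j < t.+2) g j w ord0 i +
  noise t.+1 w ord0 i) / (H * t.+1%:R)))); last by apply/funext => w; rewrite iterateE.
apply: (@measurable_clamp R _ noise_type); apply: measurable_funM => //.
apply: measurable_funN; apply: measurable_funD.
  under eq_fun do rewrite big_nat_cond big_mkcond.
  apply: measurable_sum => j.
  have [/andP[/andP[j1 jt] _]|_] := boolP ((1 <= j < t.+2)%N && true); last exact: measurable_cst.
  apply: measurable_grad_step; first by rewrite j1 /= -ltnS (leq_trans jt).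
  by apply: IH => //; rewrite j1 /= ltnW // (leq_trans jt).
under eq_fun do rewrite /noise /cover_noise summxE big_mkcond.
apply: measurable_sum => u.
have [_|_] := boolP (u \in cover t.+1); last exact: measurable_cst.
have [_|_] := boolP (leaf_noise || (0 < tag u)%N); last first.
  by under eq_fun do rewrite mxE; exact: measurable_cst.
under eq_fun do rewrite mxE.
have mi : measurable_fun [set: n.-tuple R] (fun s => tnth s i) by exact: measurable_tnth.
have mg := @measurable_gam _ _ _ _ _ _ gam u.
have mt := measurableT_comp mi mg; exact: mt.
Qed.

(* The sampling error of round t, relative to the Lovasz extension at x_t. *)
Let deviation t w :=
  f t (S t w) - (f t finset.set0 + \sum_i g t w ord0 i * x t w ord0 i).

(** The first set is a superlevel set too, at level 0, so round 1 fits [lovasz_grad_threshold]. *)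
Lemma play_first w : S 1 w = [set i | 0 < x 1 w ord0 i]%SET.
Proof.
rewrite (pftal_S1 run) (pftal_x1 run); apply/setP => i; rewrite inE mxE.
by case: (i \in S1); rewrite ?ltr01 ?ltxx.
Qed.

Lemma deviation_centered t : (1 <= t <= T)%N -> centered P (deviation t).
Proof.
move=> tT; have /andP[t1 tleT] := tT.
have tT1 : (1 <= t <= T.+1)%N by rewrite t1 leqW.
have dec w : chain_decomposes (x t w) (rule t (x t w)).
  by apply: (pftal_rule run tT).1; exact: iterate_cube.
(* In round 1 the point is a 0-1 vector and the deviation vanishes identically; sampling starts at
   round 2. *)
case: t => [//|[|t]] in t1 tT tT1 tleT dec *.
  rewrite (_ : deviation 1 = (fun=> 0)).
    by split; [exact: integrable0|exact: integral0].
  apply/funext => w; apply/eqP; rewrite subr_eq0 play_first.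
  rewrite (lovasz_grad_threshold _ 0 (dec w)); apply/eqP; congr (_ + _).
  apply: eq_bigr => i _; congr (_ * _); rewrite (pftal_x1 run) mxE.
  by case: (i \in S1); rewrite ?ltr01 ?ltxx.
set s := t.+2 in tT t1 tT1 dec *.
have sT : (2 <= s <= T.+1)%N by case/andP: tT1.
pose E pi := [set w | rule s (x s w) = pi].
have sE pi : <<s noise_events gam >> (E pi).
  by apply: measurable_iterate_step => //; exact: measurable_iterate.
(* On [E pi] the subgradient is constant, so the deviation is a finite combination of sampling
   errors of single coordinates, each centred by [threshold_prob_event]. *)
rewrite (_ : deviation s = fun w => \sum_i \sum_(pi : {perm 'I_n})
    lovasz_grad (f s) pi ord0 i *
    (\1_(E pi) w * ((tau s w < x s w ord0 i)%R%:R - x s w ord0 i))); last first.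
  apply/funext => w; rewrite /deviation (pftal_S run) //.
  rewrite (lovasz_grad_threshold _ (tau s w) (dec w)) opprD addrACA subrr add0r.
  rewrite -sumrB; apply: eq_bigr => i _; rewrite -mulrBr -/(g s w) gradE mulr_suml.
  by apply: eq_bigr => pi _; rewrite mulrA.
apply: centered_sum => i; apply: centered_sum => pi; apply: centeredZ.
set V := fun w => x s w ord0 i.
have mV : measurable_fun setT (V : noise_type -> R) by exact: measurable_iterate.
have V01 w : 0 <= V w <= 1 by exact: (iterate_cube w tT1 i).
have mE := measurable_sigma_noise_events (sE pi).
have mV' := sigma_noise_measurable_fun mV.
have mF : measurable [set w | tau s w < V w].
  have := @measurable_fun_ltr _ Omega R setT (tau s) V (measurable_funPT _) mV'.
  by move=> /(_ measurableT [set true]); rewrite setTI; apply.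
pose A w : R := \1_(E pi `&` [set w | tau s w < V w]) w.
pose B w : R := \1_(E pi) w * V w.
have iA : P.-integrable setT (EFin \o A).
  by apply: integrable_indic; exact: measurableI.
have iB : P.-integrable setT (EFin \o B).
  apply: (@bounded_integrable _ _ _ _ _ 1).
    by apply: measurable_funM => //; exact: measurable_indic.
  move=> w; rewrite /B indicE; have /andP[v0 v1] := V01 w.
  by case: (_ \in _); rewrite ?mul1r ?mul0r ?normr0 ?ler01 // ger0_norm.
rewrite (_ : (fun w => _) = A \- B); last first.
  apply/funext => w; rewrite /A /B /= mulrBr indicI /=; congr (_ * _ - _).
  rewrite indicE (_ : (w \in _) = (tau s w < V w)) //.
  by apply/idP/idP => [/set_mem|/mem_set].
split; first exact: (integrableB _ iA iB).
apply: (etrans (integralB_EFin measurableT iA iB)).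
rewrite [X in (X - _)%E](_ : _ = (\int[P]_w (B w)%:E)%E).
  by rewrite subee //; exact: (integrable_fin_num measurableT iB).
have tp := threshold_prob_event (pftal_indep run) (pftal_tau run) sT (sE pi) mV V01.
by rewrite /A integral_indic; [rewrite setIT; exact: tp|exact: measurableT|exact: measurableI].
Qed.

Lemma regret_le (M : R) w : (0 < T)%N ->
  (forall t, (1 <= t <= T)%N -> submodular (f t)) ->
  (forall t A, (1 <= t <= T)%N -> - M <= f t A <= M) ->
  regret T f (S^~ w) <= \sum_(1 <= t < T.+1) deviation t w +
  (H * T%:R * n%:R / 2 + 4 * M +
   \sum_(1 <= t < T) (4 * M) *
     (((\sum_(u in cover t) norm2 (row_of (gam u w))) / t%:R +
      2 * (4 * M) / t.+1%:R) / H)).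
Proof.
move=> T0 sub bd; rewrite /regret.
(* The minimum is attained at some [A], whose indicator [v] is the comparator of the linear
   problem. *)
have [A ->] : exists A : {set 'I_n}, \big[Num.min/total_loss T f finset.set0]_(A : {set 'I_n})
    total_loss T f A = total_loss T f A.
  elim/big_ind: _ => [|y z [A ->] [B ->]|A _]; try by eexists.
  by rewrite /Num.min; case: ifP => _; eexists.
pose v i : R := (i \in A)%:R.
have v01 i : 0 <= v i <= 1 by rewrite /v; case: (_ \in _); rewrite ?lexx ?ler01.
have x01 i : 0 <= x 1 w ord0 i <= 1 by exact: (iterate_cube w _ i).
have gB t : (1 <= t <= T)%N -> \sum_i `|g t w ord0 i| <= 4 * M.
  by move=> tT; apply: lovasz_grad_l1; [exact: sub|move=> ?; exact: bd].
have xE t i : (1 <= t < T)%N -> x t.+1 w ord0 i = clamp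
    (- (\sum_(1 <= j < t.+1) g j w ord0 i + noise t w ord0 i) / (H * t%:R)).
  by move=> /andP[t1 tT]; rewrite iterateE // t1 ltnW.
have D0 t : 0 <= \sum_(u in cover t) norm2 (row_of (gam u w)).
  by apply: sumr_ge0 => u _; exact: norm2_ge0.
have ND t i : (1 <= t < T)%N ->
    `|noise t w ord0 i| <= \sum_(u in cover t) norm2 (row_of (gam u w)).
  by move=> _; exact: cover_noise_le.
apply: le_trans (lerD (lexx _) (@noisy_leader_regret R n T H (4 * M)
  (fun t i => g t w ord0 i) (fun t i => noise t w ord0 i)
  (fun t i => x t w ord0 i) _ v H0 T0 x01 v01 xE gB D0 ND)).
rewrite /total_loss -sumrB -big_split /= !big_nat; apply: ler_sum => t tT.
have -> : \sum_i g t w ord0 i * (x t w ord0 i - v i) =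
    \sum_i g t w ord0 i * x t w ord0 i - \sum_(i in A) g t w ord0 i.
  rewrite [X in _ = _ - X]big_mkcond -sumrB; apply: eq_bigr => i _.
  by rewrite mulrBr /v; case: (i \in A); rewrite ?mulr1 ?mulr0.
have := lovasz_grad_le (rule t (x t w)) A (sub t tT).
by rewrite /deviation -/(g t w); lra.
Qed.

Lemma expected_regret_le (M b : R) : (0 < n)%N -> (0 < T)%N -> 0 < M -> 0 < b ->
  (forall t, (1 <= t <= T)%N -> submodular (f t)) ->
  (forall t A, (1 <= t <= T)%N -> - M <= f t A <= M) ->
  (forall u, has_density_prop_to P (gam u) (fun s => expR (- (norm2 (row_of s) * b)))) ->
  ('E_P[fun w => regret T f (S^~ w)] <=
   (H * T%:R * n%:R / 2 + 4 * M +
    \sum_(1 <= t < T) (4 * M / H) *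
      ((up_log 2 T).+1%:R * (6 * n%:R / b) / t%:R + 2 * (4 * M) / t.+1%:R))%:E)%E.
Proof.
move=> n0 T0 M0 b0 sub bd dens.
have normP u : mean_le P (fun w => norm2 (row_of (gam u w))) (6 * n%:R / b).
  have le := exp_norm_expectation n0 b0 (dens u); split => //.
  apply/integrableP; split.
    apply/measurable_EFinP; apply: (measurableT_comp (@measurable_norm2_row_of R n)).
    exact: measurable_funPT.
  under eq_integral do rewrite /= ger0_norm ?norm2_ge0 //.
  exact: le_lt_trans le (ltry _).
rewrite unlock -[leRHS]add0e.
have dev0 : mean_le P (fun w => \sum_(1 <= t < T.+1) deviation t w) 0.
  have := @mean_le_sum _ _ _ P nat (index_iota 1 T.+1) (fun t => (1 <= t < T.+1)%N)
    deviation (fun=> 0) (fun t tT => mean_le_centered (deviation_centered tT)).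
  by rewrite big1 //; under eq_fun do rewrite -big_nat.
have cov0 t : (1 <= t < T)%N -> mean_le P
    (fun w => (4 * M) * (((\sum_(u in cover t) norm2 (row_of (gam u w))) / t%:R +
      2 * (4 * M) / t.+1%:R) / H))
    (4 * M / H * ((up_log 2 T).+1%:R * (6 * n%:R / b) / t%:R + 2 * (4 * M) / t.+1%:R)).
  move=> /andP[t1 tT]; have [Nle _] := pftal_cover run (introT andP (conj t1 (ltnW tT))).
  rewrite (_ : (fun w => _) = (fun w => 4 * M / H * (t%:R^-1 *
    (\sum_(u in cover t) norm2 (row_of (gam u w))) + cst (2 * (4 * M) / t.+1%:R) w))); last first.
    by apply/funext => w /=; ring.
  apply: mean_leZ; first by rewrite divr_ge0 ?mulr_ge0 // ltW.
  apply: mean_leD; last exact: mean_le_cst.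
  rewrite [X in mean_le _ _ X]mulrC; apply: mean_leZ; first by rewrite invr_ge0.
  (* By linearity: at most [(up_log 2 T).+1] nodes, each with mean norm at most [6 * n%:R / b]. *)
  have [iS le] := @mean_le_sum _ _ _ P (node T) (index_enum _) (mem (cover t))
    (fun u w => norm2 (row_of (gam u w))) (fun=> 6 * n%:R / b) (fun u _ => normP u).
  split => //; apply: le_trans le _; rewrite lee_fin sumr_const -[_ *+ #|_|]mulr_natl.
  by rewrite ler_wpM2r ?ler_nat // divr_ge0 ?mulr_ge0 // ltW.
have all0 := @mean_le_sum _ _ _ P nat (index_iota 1 T) (fun t => (1 <= t < T)%N) _ _ cov0.
have [_ le] := mean_leD dev0 (mean_leD (mean_le_cst P (H * T%:R * n%:R / 2 + 4 * M)) all0).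
rewrite add0r -big_nat in le; rewrite add0e.
apply: le_trans le; apply: le_integralT => w; rewrite lee_fin -big_nat.
exact: regret_le.
Qed.

End pftal_run.

(** * Logarithmic estimates and choice of parameters *)

Lemma harmonic_le (R : realType) (T : nat) : (0 < T)%N ->
  \sum_(1 <= t < T.+1) (t%:R^-1 : R) <= 1 + ln T%:R.
Proof.
elim: T => // -[|T] IH _; first by rewrite big_nat1 invr1 ln1 addr0.
rewrite big_nat_recr //=; apply: le_trans (lerD (IH isT) (lexx _)) _.
rewrite -addrA lerD2l -lerBrDl.
have T1 : 0 < T.+1%:R :> R by rewrite ltr0n.
have T2 : 0 < T.+2%:R :> R by rewrite ltr0n.
have inv1 : T.+2%:R^-1 < 1 :> R by rewrite invf_lt1 // ltr1n.
(* [ln (1 - u) <= - u] at [u = T.+2%:R^-1] bounds the new term by an increment of the logarithm. *)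
have := @le_ln1Dx R (- T.+2%:R^-1); rewrite ltrN2 inv1 => /(_ isT).
have -> : 1 + - T.+2%:R^-1 = T.+1%:R / T.+2%:R :> R.
  by have := T2; rewrite -(natr1 T.+1) => ?; field; rewrite gt_eqF.
by rewrite ln_div ?posrE // lerNr opprB.
Qed.

Lemma up_log2_le (R : realType) (T : nat) : (0 < T)%N ->
  (up_log 2 T).+1%:R <= 2 * (1 + ln T%:R) :> R.
Proof.
move=> T0; have [->|T1] : T = 1%N \/ (1 < T)%N by lia.
  by rewrite up_log1 ln1 addr0 mulr1 ler_nat.
have := up_log_gtn (isT : (1 < 2)%N) T1; have : (0 < up_log 2 T)%N by rewrite up_log_gt0.
case: (up_log 2 T) => // k _ /=; rewrite -(ltr_nat R) natrX => kT.
(* With [up_log 2 T = k.+1] and [2 ^ k < T], this gives [k <= 2 * ln T]. *)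
have ln2 : 2^-1 <= ln 2 :> R.
  have := @le_ln1Dx R (- 2^-1); rewrite (_ : 1 + - 2^-1 = 2^-1); last by lra.
  by rewrite lnV ?posrE // => /(_ ltac:(lra)); lra.
have : ln (2 ^+ k : R) <= ln T%:R by rewrite ler_ln ?posrE ?exprn_gt0 ?ltr0n // ltW.
rewrite lnXn // -[_ *+ k]mulr_natl.
have -> : k.+2%:R = k%:R + 2 :> R by rewrite -addn2 natrD.
have : k%:R * 2^-1 <= k%:R * ln 2 :> R by rewrite ler_wpM2l.
by lra.
Qed.

(** The noiseless terms do not shrink as [eps] grows, while the target does; hence [C] depends on an
    upper bound [eps0], and on nothing else. *)
Theorem theorem7 (R : realType) :
  exists (H : nat -> nat -> R -> R) (cH : R) (k : nat),
    (forall (n T : nat) (M : R), (0 < n)%N -> (0 < T)%N -> 0 < M ->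
       0 < H n T M <= cH * (M * Num.sqrt T%:R / Num.sqrt n%:R)) /\
    forall eps0 : R, 0 < eps0 ->
    exists C : R, 0 < C /\
      forall (n T : nat) (M eps : R),
        (0 < n)%N -> (0 < T)%N -> 0 < M -> 0 < eps <= eps0 ->
      forall f : nat -> {set 'I_n} -> R,
        (forall t, (1 <= t <= T)%N -> submodular (f t)) ->
        (forall t S, (1 <= t <= T)%N -> - M <= f t S <= M) ->
      forall (d : measure_display) (Omega : measurableType d)
        (P : probability Omega R) (leaf_noise : bool)
        (cover : nat -> {set node T})
        (rule : nat -> 'rV[R]_n -> {perm 'I_n}) (S1 : {set 'I_n})
        (gam : node T -> {RV P >-> n.-tuple R}) (tau : nat -> {RV P >-> R})
        (x : nat -> Omega -> 'rV[R]_n) (S : nat -> Omega -> {set 'I_n}),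
        submod_pftal f (H n T M) (4 * M + H n T M * Num.sqrt n%:R) eps
          leaf_noise cover rule S1 gam tau x S ->
        ('E_P[fun w => regret T f (S^~ w)] <=
         (C * (1 + ln T%:R) ^+ k *
          (n%:R `^ (3 / 2) * M * Num.sqrt T%:R / eps))%:E)%E.
Proof.
have sqrt1 (m : nat) : (0 < m)%N -> 1 <= Num.sqrt m%:R :> R.
  by move=> m0; rewrite -[leLHS]sqrtr1 ler_wsqrtr // ler1n.
(* Then [H * T * n / 2] and [4 * M / H] are both of order [sqrt (n * T)], up to a factor [M]. Of the
   three logarithms, one comes from the harmonic sum, one from the number of nodes and one from the
   noise scale. *)
exists (fun n T M => M / (Num.sqrt n%:R * Num.sqrt T%:R)), 1, 3%N; split.
  move=> n T M n0 T0 M0; have sn := sqrt1 n n0; have sT := sqrt1 T T0.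
  have sn0 : 0 < Num.sqrt n%:R :> R by apply: lt_le_trans sn.
  have sT0 : 0 < Num.sqrt T%:R :> R by apply: lt_le_trans sT.
  rewrite divr_gt0 ?mulr_gt0 //= mul1r invfM mulrA -mulrA [_^-1 * _]mulrC mulrA.
  rewrite ler_wpM2r ?invr_ge0 ?(ltW sn0) // ler_wpM2l ?(ltW M0) //.
  by rewrite (le_trans _ sT) // invf_le1.
(* The noiseless terms add up to [1/2 + 4 + 32 <= 37] times [W]; the noise contributes
   [480 = 4 * 120]. *)
move=> eps0 e00; exists (37 * eps0 + 480); split; first by lra.
move=> n T M eps n0 T0 M0 /andP[e0 ee0] f sub bd d Omega P leaf_noise cover rule S1
  gam tau x S; set sn := Num.sqrt n%:R; set sT := Num.sqrt T%:R.
have sn1 : 1 <= sn := sqrt1 n n0; have sT1 : 1 <= sT := sqrt1 T T0.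
have sn0 : 0 < sn by apply: lt_le_trans sn1.
have sT0 : 0 < sT by apply: lt_le_trans sT1.
set H := M / (sn * sT); set L := 4 * M + H * sn => run.
have H0 : 0 < H by rewrite /H divr_gt0 ?mulr_gt0.
have L0 : 0 < L by rewrite /L; apply: addr_gt0; apply: mulr_gt0.
have L5 : L <= 5 * M.
  rewrite (_ : L = 4 * M + M / sT); last by rewrite /L /H; field; rewrite !gt_eqF.
  have : M / sT <= M by rewrite ler_pdivrMr // ler_peMr // ltW.
  by lra.
set l := (up_log 2 T).+1%:R : R; have l0 : 0 < l by rewrite ltr0n.
pose b := eps / (L * l); have b0 : 0 < b by rewrite /b divr_gt0 ?mulr_gt0.
have dens u : has_density_prop_to P (gam u) (fun s => expR (- (norm2 (row_of s) * b))).
  have [c cP] := pftal_noise run u; exists c => A mA; rewrite (cP A mA).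
  by congr (_ * lebesgue_int _)%E; apply/funext => s; rewrite /noise_kernel /b -mulrA.
apply: le_trans (expected_regret_le run H0 n0 T0 M0 b0 sub bd dens) _; rewrite lee_fin.
have nE : n%:R = sn ^+ 2 by rewrite sqr_sqrtr.
have TE : T%:R = sT ^+ 2 by rewrite sqr_sqrtr.
have -> : n%:R `^ (3 / 2) = sn ^+ 3.
  rewrite (_ : 3 / 2 = 1 + 2^-1); last by lra.
  rewrite powRD; last by rewrite pnatr_eq0 -lt0n n0 implybT.
  by rewrite powRr1 // powR12_sqrt // -/sn [in LHS]nE -exprSr.
set lam := 1 + ln T%:R; have lam1 : 1 <= lam by rewrite /lam lerDl ln_ge0 // ler1n.
have l2 : l <= 2 * lam by exact: up_log2_le.
(* Replacing [t.+1%:R^-1] by [t%:R^-1] merges noise and drift into one harmonic sum. *)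
set K := l * (6 * n%:R / b) + 8 * M.
have K0 : 0 <= K.
  apply: addr_ge0; last by rewrite mulr_ge0 // ltW.
  by apply: mulr_ge0; [exact: ltW|rewrite divr_ge0 ?(ltW b0) // mulr_ge0].
have sum_le : \sum_(1 <= t < T) (4 * M / H) *
      (l * (6 * n%:R / b) / t%:R + 2 * (4 * M) / t.+1%:R) <= 4 * sn * sT * (lam * K).
  rewrite -mulr_sumr (_ : 4 * M / H = 4 * sn * sT); last first.
    by rewrite /H; field; rewrite !gt_eqF.
  rewrite ler_wpM2l ?mulr_ge0 ?(ltW sn0) ?(ltW sT0) //.
  apply: (@le_trans _ _ (\sum_(1 <= t < T) t%:R^-1 * K)).
    rewrite !big_nat; apply: ler_sum => t /andP[t1 _]; rewrite /K.
    have tt : t.+1%:R^-1 <= t%:R^-1 :> R by rewrite lef_pV2 ?posrE ?ltr0n // ler_nat.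
    have : 8 * M * t.+1%:R^-1 <= 8 * M * t%:R^-1 by rewrite ler_wpM2l // mulr_ge0 ?(ltW M0).
    by set X := l * _; set a := t%:R^-1; set c := t.+1%:R^-1; lra.
  rewrite -mulr_suml ler_wpM2r //; apply: le_trans _ (harmonic_le R T0).
  by rewrite big_nat_recr //= lerDl invr_ge0.
apply: (le_trans (lerD (lexx _) sum_le)).
have ei0 : 0 < eps^-1 by rewrite invr_gt0.
(* [120 = 6 * 5 * 2 ^ 2], from the mean norm, [L <= 5 * M] and [l <= 2 * lam]. *)
have KE : K <= 120 * sn ^+ 2 * M * lam ^+ 2 * eps^-1 + 8 * M.
  rewrite lerD2r (_ : l * (6 * n%:R / b) = 6 * sn ^+ 2 * eps^-1 * (L * l ^+ 2)); last first.
    by rewrite nE /b; field; rewrite !gt_eqF.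
  rewrite (_ : 120 * _ * _ * _ * _ = 6 * sn ^+ 2 * eps^-1 * (5 * M * (2 * lam) ^+ 2)); last by ring.
  apply: ler_wpM2l.
    by apply: mulr_ge0; [apply: mulr_ge0 => //; exact: sqr_ge0|exact: ltW].
  apply: ler_pM; rewrite ?sqr_ge0 ?(ltW L0) //.
  by rewrite lerXn2r ?nnegrE ?(ltW l0) // (le_trans (ltW l0)).
have lam0 : 0 < lam by apply: lt_le_trans lam1.
pose W := M * (sn * sT) * lam.
have st1 : 1 <= sn * sT by rewrite mulr_ege1.
have W1 : M * (sn * sT) <= W by rewrite ler_peMr ?mulr_ge0 ?(ltW M0) ?(ltW sn0) ?(ltW sT0).
have W2 : M <= W by apply: le_trans W1; rewrite ler_peMr ?(ltW M0).
(* Here [eps <= eps0] is what absorbs the noiseless terms. *)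
have WQ : W <= eps0 * (lam ^+ 3 * (sn ^+ 3 * M * sT / eps)).
  rewrite (_ : eps0 * _ = W * (sn ^+ 2 * lam ^+ 2 * (eps0 / eps))); last by rewrite /W; ring.
  have ee1 : 1 <= eps0 / eps by rewrite ler_pdivlMr // mul1r.
  rewrite ler_peMr //; first exact: le_trans (ltW M0) W2.
  by apply: mulr_ege1 => //; apply: mulr_ege1; exact: exprn_ege1.
have HTn : H * T%:R * n%:R / 2 = M * (sn * sT) / 2.
  by rewrite nE TE /H; field; rewrite !gt_eqF.
have : 4 * sn * sT * (lam * K) <=
    4 * sn * sT * (lam * (120 * sn ^+ 2 * M * lam ^+ 2 * eps^-1 + 8 * M)).
  by rewrite ler_wpM2l ?mulr_ge0 ?(ltW sn0) ?(ltW sT0) // ler_wpM2l // ltW.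
rewrite HTn (_ : 4 * sn * sT * (lam * (120 * _ * _ * _ * _ + _)) =
  480 * (lam ^+ 3 * (sn ^+ 3 * M * sT / eps)) + 32 * W); last by rewrite /W; ring.
move=> KW; rewrite -[leRHS]mulrA; move: W1 W2 WQ KW.
set Q := lam ^+ 3 * _; set V := M * (sn * sT); set U := 4 * sn * sT * _.
by lra.
Qed.
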